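(* Assume the following hypothesis: every local minimizer $\gamma$ of $\mathcal{F}$ in $\mathcal{A}_{\mathrm{clamp}}$ belongs to $C^2([0,L];\mathbf{R}^2)$. Let $\gamma\in\mathcal{A}_{\mathrm{clamp}}$ be well-periodic, with signed curvature $k$, and suppose there are three points $0\le s_1<s_2<s_3\le L$ with $s_3-s_1<L$ such that $$k(s_1)=k(s_2)=k(s_3)=0.$$ Then $\gamma$ is not a local minimizer of $\mathcal{F}$ in $\mathcal{A}_{\mathrm{clamp}}$.
   Context: Let $p\in(1,\infty)$, $L>0$, and $P_0,P_1,V_0,V_1\in\mathbf{R}^2$ with $|P_0-P_1|<L$ and $|V_0|=|V_1|=1$. Let $W^{2,p}_{\mathrm{arc}}(0,L;\mathbf{R}^2):=\{\gamma\in W^{2,p}(0,L;\mathbf{R}^2) : |\gamma'|\equiv 1\}$ and $$\mathcal{A}_{\mathrm{clamp}}:=\{\gamma\in W^{2,p}_{\mathrm{arc}}(0,L;\mathbf{R}^2) : \gamma(0)=P_0,\ \gamma(L)=P_1,\ \gamma'(0)=V_0,\ \gamma'(L)=V_1\},$$ equipped with the relative topology induced by the $W^{2,p}$-norm. The signed curvature $k$ of an arclength parametrized planar curve $\gamma$ is defined by $\gamma''=kN$, where $N$ is $\gamma'$ rotated counterclockwise by $\pi/2$. Let $f:[0,\infty)\to[0,\infty]$ be a Borel function and $\mathcal{F}(\gamma):=\int_0^L f(|k|)\,ds$. A local minimizer of $\mathcal{F}$ in $X$ is an $x\in X$ with $\mathcal{F}(x)\le\mathcal{F}(x')$ for all $x'$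 in some neighborhood of $x$ in $X$. An arclength parametrized planar curve $\gamma:[0,L]\to\mathbf{R}^2$ is well-periodic if it has continuous signed curvature $k\in C([0,L])$ of the form $k(s)=\Phi(s-s_0)$, where $s_0\in\mathbf{R}$ and $\Phi\in C(\mathbf{R})$ is an odd function that is antiperiodic with antiperiod $T>0$ (i.e. $\Phi(x+T)=-\Phi(x)$ for all $x$) such that $\{s\in\mathbf{R}:\Phi(s)=0\}=T\mathbf{Z}$. *)

(* Defs.v *)
From HB Require Import structures.
From mathcomp Require Export all_boot all_order all_algebra.
From mathcomp Require Export all_classical all_reals all_analysis.
From mathcomp Require Export measurable_realfun.

Set Implicit Arguments.
Unset Strict Implicit.
Unset Printing Implicit Defensive.

Export Order.TTheory GRing.Theory Num.Theory.
Export numFieldNormedType.Exports.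

Local Open Scope classical_set_scope.
Local Open Scope ring_scope.

Section Plane.
Context {R : realType}.

(* The norm `|v| of 'rV[R]_2 in the library is the sup norm. *)
Definition enorm (v : 'rV[R]_2) : R :=
  Num.sqrt (v ord0 ord0 ^+ 2 + v ord0 ord_max ^+ 2).

(* Counterclockwise rotation by pi/2: (x, y) |-> (-y, x). *)
Definition rot90 (v : 'rV[R]_2) : 'rV[R]_2 :=
  \row_j (if j == ord0 then - v ord0 ord_max else v ord0 ord0).

End Plane.

(* A curve is a total function R -> R^2 of which only the values on [0, L]
   (or almost everywhere on (0, L), for derivatives in the weak sense)
   matter. *)
Section Sobolev.
Context {R : realType}.
Local Notation mu := (@lebesgue_measure R).
Local Notation curve := (R -> 'rV[R]_2).
Implicit Types (L p : R) (u g : curve).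

(* C^1_c(0, L). *)
Definition test_function L (phi : R -> R) : Prop :=
  [/\ forall x, derivable phi x 1,
      continuous (derive1 phi),
      compact (closure [set x | phi x != 0]) &
      closure [set x | phi x != 0] `<=` `]0, L[].

(* Weak derivatives on an interval are tested against C^1_c functions, as in
   Brezis, "Functional Analysis, Sobolev Spaces and PDE", 8.2; by mollification
   testing against C^oo_c functions gives the same notion. *)
Definition weak_derivative L u g : Prop :=
  forall i : 'I_2,
    [/\ locally_integrable `]0, L[ (fun s => u s ord0 i),
        locally_integrable `]0, L[ (fun s => g s ord0 i) &
        forall phi, test_function L phi ->
          \int[mu]_(s in `]0, L[) (u s ord0 i * (derive1 phi) s) =
          - \int[mu]_(s in `]0, L[) (g s ord0 i * phi s)].

(* A representative of the weak derivative, which is unique a.e. on (0, L);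
   junk if there is none. *)
Definition wderive L u : curve :=
  xget (fun=> 0) [set g | weak_derivative L u g].

Definition mem_Lp L p u : Prop :=
  forall i : 'I_2,
    (fun s => u s ord0 i) \_ `]0, L[ \in Lfun mu p%:E.

Definition Lp_norm L p u : \bar R :=
  'N[mu]_p%:E[EFin \o ((enorm \o u) \_ `]0, L[)].

(* W^{2,p}(0, L; R^2), each class being represented by its member that is
   continuous on [0, L]. *)
Definition W2p L p u : Prop :=
  {within `[0, L], continuous u} /\
  exists g h, [/\ mem_Lp L p u, mem_Lp L p g, mem_Lp L p h,
                  weak_derivative L u g & weak_derivative L g h].

Definition W2p_norm L p u : \bar R :=
  (Lp_norm L p u + Lp_norm L p (wderive L u)
   + Lp_norm L p (wderive L (wderive L u)))%E.

(* gamma' as a function on all of [0, L]: the continuous representative of the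
   weak derivative, which exists by W^{2,p}(0, L) <= C^1([0, L]). *)
Definition velocity L u : curve :=
  xget (fun=> 0)
    [set v | {within `[0, L], continuous v} /\ weak_derivative L u v].

Definition arclength L u : Prop :=
  forall s, s \in `[0, L] -> enorm (velocity L u s) = 1.

(* C^2([0, L]; R^2): twice continuously differentiable on (0, L), with all
   derivatives up to order 2 extending continuously to [0, L]. *)
Definition C2 L u : Prop :=
  exists u1 u2 : curve,
    [/\ {within `[0, L], continuous u},
        {within `[0, L], continuous u1},
        {within `[0, L], continuous u2},
        forall s, s \in `]0, L[ -> is_derive s 1 u (u1 s) &
        forall s, s \in `]0, L[ -> is_derive s 1 u1 (u2 s)].

End Sobolev.

Section Curvature.
Context {R : realType}.
Local Notation mu := (@lebesgue_measure R).
Local Notation curve := (R -> 'rV[R]_2).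
Implicit Types (L p : R) (gamma : curve) (k : R -> R).

(* gamma'' = k N in the weak sense, with N = rot90 gamma'. *)
Definition signed_curvature L gamma k : Prop :=
  weak_derivative L (velocity L gamma)
    (fun s => k s *: rot90 (velocity L gamma s)).

Definition curvature L gamma : R -> R :=
  xget (fun=> 0) [set k | signed_curvature L gamma k].

Definition energy L (f : R -> \bar R) gamma : \bar R :=
  (\int[mu]_(s in `]0%R, L[) f `|curvature L gamma s|%R)%E.

Definition A_clamp L p (P0 P1 V0 V1 : 'rV[R]_2) : set curve :=
  [set gamma | [/\ W2p L p gamma, arclength L gamma,
                   gamma 0 = P0 /\ gamma L = P1 &
                   velocity L gamma 0 = V0 /\ velocity L gamma L = V1]].

(* Neighborhoods are those of the topology induced on X by the W^{2,p} norm. *)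
Definition local_minimizer L p (F : curve -> \bar R) (X : set curve) gamma :
    Prop :=
  X gamma /\
  exists2 delta : R, 0 < delta &
    forall eta, X eta -> (W2p_norm L p (eta \- gamma)%R < delta%:E)%E ->
      (F gamma <= F eta)%E.

(* gamma is well-periodic, and k is its continuous signed curvature. *)
Definition well_periodic L gamma k : Prop :=
  [/\ arclength L gamma,
      {within `[0, L], continuous k},
      signed_curvature L gamma k &
      exists (s0 T : R) (Phi : R -> R),
        [/\ 0 < T /\ continuous Phi,
            forall x, Phi (- x) = - Phi x,
            forall x, Phi (x + T) = - Phi x,
            [set x | Phi x = 0] = [set x | exists m : int, x = m%:~R * T] &
            forall s, s \in `[0, L] -> k s = Phi (s - s0)]].

End Curvature.

(* Main.v *)
Require Import Defs.
From mathcomp Require Import zify ring lra.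

(* Between s1 and s3 the curvature k runs through a full period [a, a + 2T]
   (a = s1) on which it is odd about a; hence the tangent V is 2T-periodic and
   V(a - x) = V(a + x). For small e with c = a - e and c + 2T inside (0, L)
   (e > 0 if a > 0, and e < 0 otherwise), replace V(s) on [c, c + 2T] by
   V(s + 2e). The new tangent is continuous because V(c + 2e) = V(c), the
   endpoints do not move because V is integrated over a full period, and the
   energy does not change because |k| is rearranged over a full period. The new
   curve is W^{2,p}-close to the old one, so it would be a local minimizer too,
   hence C^2; but its curvature jumps at c from the nonzero value k(a - e) to
   k(a + e) = - k(a - e). *)

Set Implicit Arguments.
Unset Strict Implicit.
Unset Printing Implicit Defensive.

Local Open Scope classical_set_scope.
Local Open Scope ring_scope.

(** * Calculus on the line *)

Section Calculus.
Context {R : realType}.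
Local Notation mu := (@lebesgue_measure R).
Implicit Types (f g w F : R -> R) (a b c d e l m x L : R).

(** The new arc uses the tangent on [[a + e, a + e + 2T]], which may stick out of [[0, L]] at either
    end. So the tangent is extended to the whole line, as a fixed vector rotated by a primitive of
    the extended curvature. That primitive carries the symmetries: it is even about [a] because the
    curvature is odd there, and evenness together with the period of the curvature makes it
    2T-periodic. The shift is [2e] because reflection about [a] exchanges [a - e] and [a + e]. The
    strict inequality [s3 - s1 < L] leaves room to slide the window until both its ends are
    interior, which preserves the clamped data and puts the jump at an interior point.

    The other obstacle is that derivative, tangent and curvature are weak objects, selected by
    choice among representatives. Each must be shown independent of that choice, which rests on the
    fundamental lemma of the calculus of variations and on the fact that a continuous weak
    derivative is a classical one. The competitor is the curve plus a correction that vanishes with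
    its first derivative at both ends of the window, so its extension by zero has two weak
    derivatives. *)

Lemma is_derive_continuous f g :
  (forall x : R, is_derive x 1 f (g x)) -> continuous f.
Proof.
move=> fg x; apply/differentiable_continuous/derivable1_diffP.
exact: ex_derive.
Qed.

Lemma is_derive_LRcontinuous f g a b :
  (forall x : R, is_derive x 1 f (g x)) -> derivable_oo_LRcontinuous f a b.
Proof.
move=> fg; have fc := is_derive_continuous fg; split.
- by move=> x _; exact: ex_derive.
- by apply: cvg_at_right_filter; exact: fc.
- by apply: cvg_at_left_filter; exact: fc.
Qed.

Lemma is_derive1E f (x l : R) : is_derive x 1 f l -> derive1 f x = l.
Proof. by move=> fl; rewrite derive1E; exact: derive_val. Qed.

Lemma continuous_integrable f a b : continuous f ->
  mu.-integrable `[a, b] (EFin \o f).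
Proof.
move=> fc; apply: continuous_compact_integrable; first exact: segment_compact.
exact: continuous_subspaceT.
Qed.

Lemma Rintegral_itv_cat f a b c : continuous f -> a <= b -> b <= c ->
  \int[mu]_(t in `[a, c]) f t =
  \int[mu]_(t in `[a, b]) f t + \int[mu]_(t in `[b, c]) f t.
Proof.
move=> fc ab bc; apply/eqP; rewrite addrC -subr_eq; apply/eqP.
rewrite Rintegral_itvB ?bnd_simp//; last exact: continuous_integrable.
rewrite Rintegral_itv_obnd_cbnd//.
apply: integrableS (continuous_integrable b c fc) => //.
exact: subset_itv_oc_cc.
Qed.

(** Integrals over sets carry no orientation, so [F] subtracts the integral over [[s, 0]]; for every
    [s] at least one of the two sets is null. *)
Lemma continuous_primitive f : continuous f ->
  exists F, forall x : R, is_derive x 1 F (f x).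
Proof.
move=> fc.
pose F s := \int[mu]_(t in `[0, s]) f t - \int[mu]_(t in `[s, 0]) f t.
(* The fundamental theorem needs a base point to the left of [x]. Taking [m] below both [0] and [x]
   makes [F] differ from the integral from [m] by a constant near [x]. *)
exists F => x; pose m := Num.min 0 x - 1.
have mx : m < x by rewrite /m ltrBlDr gt_min ltrDl ltr01 orbT.
have m0 : m < 0 by rewrite /m ltrBlDr gt_min ltrDl ltr01.
have FE t : m < t ->
    \int[mu]_(t in `[m, t]) f t - \int[mu]_(t in `[m, 0]) f t = F t.
  move=> mt; rewrite /F; have [t0|t0] := leP 0 t.
    rewrite (@Rintegral_itv_cat f m 0 t) ?(ltW m0)// addrAC subrr add0r.
    suff -> : \int[mu]_(t in `[t, 0]) f t = 0 by rewrite subr0.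
    move: t0; rewrite le_eqVlt => /predU1P[<-|t0].
      by rewrite set_itv1 Rintegral_set1.
    by rewrite set_itv_ge ?Rintegral_set0// bnd_simp -ltNge.
  rewrite (@Rintegral_itv_cat f m t 0) ?(ltW mt) ?(ltW t0)//.
  have -> : \int[mu]_(t in `[0, t]) f t = 0.
    by rewrite set_itv_ge ?Rintegral_set0// bnd_simp -ltNge.
  by rewrite opprD addrA subrr.
have x1 : x < x + 1 by rewrite ltrDl.
have [dF dF'] := @continuous_FTC1_closed R f m x (x + 1) x1
  (continuous_integrable _ _ fc) mx (fc x).
have H : is_derive x 1 (fun y => \int[mu]_(t in `[m, y]) f t) (f x).
  by apply: DeriveDef => //; rewrite -derive1E.
pose c := \int[mu]_(t in `[m, 0]) f t.
have {}H : is_derive x 1 (fun y => \int[mu]_(t in `[m, y]) f t - c) (f x).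
  by apply: is_derive_eq; rewrite subr0.
apply: near_eq_is_derive H; near=> t; apply: FE.
by near: t; exact: lt_nbhsr.
Unshelve. all: by end_near. Qed.

Lemma continuous_FTC f F a b : (forall x : R, is_derive x 1 F (f x)) ->
  continuous f -> a <= b -> \int[mu]_(t in `[a, b]) f t = F b - F a.
Proof.
move=> Ff fc; rewrite le_eqVlt => /predU1P[->|ab].
  by rewrite set_itv1 Rintegral_set1 subrr.
rewrite /Rintegral (@continuous_FTC2 R f F)//.
- exact: continuous_subspaceT.
- exact: is_derive_LRcontinuous.
- by move=> x _; exact: is_derive1E.
Qed.

Lemma derive0_constant_segment w L : {within `[0, L], continuous w} ->
  (forall x : R, x \in `]0, L[ -> is_derive x 1 w 0) ->
  forall x, x \in `[0, L] -> w x = w 0.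
Proof.
move=> wc w0 x xL; have /andP[x0 xL'] : 0 <= x <= L by rewrite in_itv in xL.
have sub (y : R) : y \in `]0, x[ -> y \in `]0, L[.
  by rewrite !in_itv/= => /andP[-> /lt_le_trans->].
have [|||c _ /eqP] := @MVT_segment R w (cst 0) 0 x => //.
- by move=> y /sub; exact: w0.
- apply: continuous_subspaceW wc => y /=.
  by rewrite !in_itv/= => /andP[-> /le_trans->].
by rewrite mul0r subr_eq0 => /eqP.
Qed.

(** Compactness of [[a, b]] turns continuity at each point into one bound on the shift. Radii are
    halved so that both [y] and [y + h] stay in the ball where [f] is controlled. *)
Lemma continuous_uniform_shift f a b e : continuous f -> 0 < e ->
  exists2 d, 0 < d & forall h, `|h| < d ->
    forall x, x \in `[a, b] -> `|f (x + h) - f x| < e.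
Proof.
move=> fc e0; have := @segment_compact R a b.
move=> /compact_near_coveringP/(_ R (nbhs (0 : R))
  (fun h x => `|f (x + h) - f x| < e) _) [].
  move=> x _.
  have e2 : 0 < e / 2 by rewrite divr_gt0.
  have /cvgrPdist_lt/(_ _ e2)[d /= d0 fd] := fc x.
  have d2 : 0 < d / 2 by rewrite divr_gt0.
  exists (ball x (d / 2), ball 0 (d / 2)) => /=.
    by split; exact: nbhsx_ballx.
  move=> [y h] [/= xy h0].
  have {}xy : `|x - y| < d / 2 by [].
  have {}h0 : `|h| < d / 2 by move: h0; rewrite /ball/= sub0r normrN.
  have fy : `|f x - f y| < e / 2.
    by apply: fd => /=; rewrite (lt_le_trans xy)// ler_pdivrMr// ler_pMr//; lra.
  have fyh : `|f x - f (y + h)| < e / 2.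
    apply: fd => /=; rewrite opprD addrA (le_lt_trans (ler_normB _ _))//.
    by rewrite [ltRHS]splitr ltrD.
  have -> : f (y + h) - f y = (f x - f y) - (f x - f (y + h)) by ring.
  by rewrite (le_lt_trans (ler_normB _ _))// [ltRHS]splitr ltrD.
move=> d /= d0 H; exists d => // h hd x xab; apply: (H h) => //=.
by rewrite sub0r normrN.
Qed.

(** The difference quotients of [f - g] vanish at points arbitrarily close to [b], so their limit
    does. Agreement on one side of [b] is enough, which is how derivatives at the junction point are
    compared. *)
Lemma is_derive_accumulation_eq f g (b l m : R) :
  is_derive b 1 f l -> is_derive b 1 g m -> f b = g b ->
  (forall e, 0 < e -> exists t, [/\ t != b, `|t - b| < e & f t = g t]) -> l = m.
Proof.
move=> fl gm fgb fg; apply/eqP; rewrite -subr_eq0; apply/negPn/negP => lm.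
have [d' dE] : is_derive b 1 (f - g) (l - m) by exact: is_deriveB.
have : h^-1 *: ((f - g) (h *: 1 + b) - (f - g) b) @[h --> (0 : R)^'] --> l - m.
  by rewrite -dE; exact: d'.
have lm0 : 0 < `|l - m| by rewrite normr_gt0.
move=> /cvgrPdist_lt/(_ _ lm0)[d /= d0 H].
have [t [tb tbd fgt]] := fg _ d0.
have /= := H (t - b); rewrite sub0r normrN => /(_ tbd).
rewrite subr_eq0 => /(_ tb).
rewrite [(t - b) *: 1]mulr1 subrK !fctE fgb fgt !subrr scaler0 subr0.
by rewrite ltxx.
Qed.

End Calculus.

(** * Test functions *)

Section TestFunctions.
Context {R : realType}.
Local Notation mu := (@lebesgue_measure R).
Implicit Types (f g h w F : R -> R) (a b c d e l m x L : R).

Lemma test_function_of_support L f g c d : 0 < c -> d < L ->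
  (forall x : R, is_derive x 1 f (g x)) -> continuous g ->
  (forall x, x \notin `[c, d] -> f x = 0) -> test_function L f.
Proof.
move=> c0 dL fg gc f0.
have sub : closure [set x | f x != 0] `<=` `[c, d]%classic.
  rewrite [X in _ `<=` X](closure_id _).1; last exact: interval_closed.
  apply: closure_subset => x /= fx; apply/negPn/negP => xcd.
  by move: fx; rewrite f0 ?eqxx.
split.
- by move=> x; exact: ex_derive.
- have -> : derive1 f = g by apply/funext => x; exact: is_derive1E.
  exact: gc.
- apply: (subclosed_compact _ (@segment_compact R c d) sub).
  exact: closed_closure.
- move=> x /sub /=; rewrite !in_itv/= => /andP[cx xd].
  by rewrite (lt_le_trans c0)// (le_lt_trans xd).
Qed.

Lemma test_function_support L f : test_function L f ->
  exists K : set R, [/\ compact K, K `<=` `]0, L[,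
    forall x, ~ K x -> f x = 0 & forall x, ~ K x -> derive1 f x = 0].
Proof.
move=> [df _ cK KL]; exists (closure [set x | f x != 0]).
have f0 x : ~ closure [set x | f x != 0] x -> f x = 0.
  move=> Kx; apply/eqP/negPn/negP => fx; apply: Kx.
  exact: subset_closure.
split => // x Kx.
have oK : open (~` closure [set x | f x != 0]).
  by apply: closed_openC; exact: closed_closure.
rewrite derive1E -(@derive_cst R R R (0 : R) x 1).
apply: near_eq_derive.
have : nbhs x (~` closure [set x | f x != 0]) by exact: open_nbhs_nbhs.
apply: filterS => y Ky.
by rewrite f0.
Qed.

(** [g] need not be integrable up to the ends of the interval; the product only sees [K], on which
    [g] is integrable and [f] bounded. *)
Lemma locally_integrable_mul_test g f (K : set R) L :
  locally_integrable `]0, L[ g -> compact K -> K `<=` `]0, L[ ->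
  continuous f -> (forall x, ~ K x -> f x = 0) ->
  mu.-integrable `]0, L[ (EFin \o (fun x => g x * f x)).
Proof.
move=> [mg _ ig] cK KL fc f0.
have mK := compact_measurable cK.
have : mu.-integrable K (fun x => (g x)%:E * (f x)%:E)%E.
  apply: integrableMl => //.
  - apply/integrableP; split; last exact: ig.
    by apply/measurable_EFinP; exact: measurable_funS mg.
  - by apply: measurable_funTS; exact: continuous_measurable_fun.
  - have := compact_bounded (continuous_compact (continuous_subspaceT fc) cK).
    by case=> M [Mr HM]; exists M; split => // y My x Kx; apply: HM => //;
      exists x.
have KE : `]0, L[ `&` K = K by rewrite setIC; exact: setIidl.
rewrite -{1}KE integrable_restrict//.
apply: eq_integrable => // x _; rewrite patchE /=.
case: ifPn => //; rewrite notin_setE => /f0 ->.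
by rewrite mulr0.
Qed.

Lemma test_function_mul_integrable L g f : locally_integrable `]0, L[ g ->
  test_function L f -> mu.-integrable `]0, L[ (EFin \o (fun x => g x * f x)).
Proof.
move=> ig tf; have [K [cK KL f0 _]] := test_function_support tf.
apply: (locally_integrable_mul_test ig cK KL) => //.
by move=> x; apply/differentiable_continuous/derivable1_diffP; case: tf.
Qed.

Lemma test_function_mul_derive_integrable L g f : locally_integrable `]0,
  L[ g ->
  test_function L f ->
  mu.-integrable `]0, L[ (EFin \o (fun x => g x * derive1 f x)).
Proof.
move=> ig tf; have [K [cK KL _ f0]] := test_function_support tf.
by apply: (locally_integrable_mul_test ig cK KL) => //; case: tf.
Qed.

(** The bump is half the squared positive part of [(x - c) * (d - x)]. Squaring the positive part
    makes it C^1; here it appears as a primitive [P] of the positive part. *)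
Lemma C1_bump c d : c < d -> exists b b' : R -> R,
  [/\ forall x : R, is_derive x 1 b (b' x), continuous b',
      forall x, x \in `]c, d[ -> 0 < b x,
      forall x, 0 <= b x & forall x, x \notin `]c, d[ -> b x = 0].
Proof.
move=> cd.
pose pos (t : R) := Num.max t 0.
have posc : continuous pos.
  by move=> t; apply: continuous_max => //; exact: cst_continuous.
have [P P'] := continuous_primitive posc.
have Pc : continuous P := is_derive_continuous P'.
pose q (x : R) := (x - c) * (d - x).
pose q' (x : R) := (d - x) - (x - c).
have dq (x : R) : is_derive x 1 q (q' x).
  rewrite /q /q'; apply: is_derive_eq; rewrite /GRing.scale/=; ring.
have qc := is_derive_continuous dq.
have Pneg t : t <= 0 -> P t - P 0 = 0.
  move=> t0; apply/eqP; rewrite -oppr_eq0 opprB; apply/eqP.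
  have [|z zt ->] := @MVT_segment R P pos t 0 t0 => //.
  - exact: continuous_subspaceT.
  - rewrite /pos max_r ?mul0r//; by move: zt; rewrite in_itv/= => /andP[].
have Ppos t : 0 < t -> 0 < P t - P 0.
  move=> t0.
  have [|z zt ->] := @MVT R P pos 0 t t0 => //.
  - exact: continuous_subspaceT.
  - rewrite subr0 mulr_gt0// /pos lt_max.
    by move: zt; rewrite in_itv/= => /andP[->].
have qpos x : (0 < q x) = (x \in `]c, d[).
  rewrite in_itv/= /q; apply/idP/idP => [|/andP[cx xd]]; last first.
    by rewrite mulr_gt0// subr_gt0.
  move=> H; apply/andP; split; nra.
exists (fun x => P (q x) - P 0), (fun x => q' x * pos (q x)); split.
- move=> x; have H := is_derive1_comp (P' (q x)) (dq x).
  apply: (is_derive_eq (is_deriveB H (is_derive_cst (P 0) x 1))).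
  by rewrite subr0 mulrC.
- have q'c : continuous q'.
    apply: (@is_derive_continuous _ _ (cst (- 2))) => x.
    by rewrite /q'; apply: is_derive_eq; rewrite /=; ring.
  move=> x; apply: cvgM; first exact: q'c.
  by apply: continuous_comp; [exact: qc|exact: posc].
- by move=> x; rewrite -qpos; exact: Ppos.
- move=> x; have [/Ppos/ltW //|/Pneg ->//] := ltP 0 (q x).
- by move=> x; rewrite -qpos -leNgt => /Pneg.
Qed.

End TestFunctions.

(** * The fundamental lemma of the calculus of variations *)

Section DuBoisReymond.
Context {R : realType}.
Local Notation mu := (@lebesgue_measure R).
Implicit Types (f g h w F : R -> R) (a b c d e l m x L : R).

Lemma locally_integrable_segment h L c d : locally_integrable `]0, L[ h ->
  0 < c -> d < L -> mu.-integrable `[c, d] (EFin \o h).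
Proof.
move=> [mh _ ih] c0 dL.
have sub : `[c, d]%classic `<=` `]0, L[.
  move=> x /=; rewrite !in_itv/= => /andP[cx xd].
  by rewrite (lt_le_trans c0)// (le_lt_trans xd).
apply/integrableP; split.
  by apply/measurable_EFinP; exact: measurable_funS mh.
by apply: ih => //; exact: segment_compact.
Qed.

(* [n b / (1 + n b)] tends to the indicator of the interval as [n] grows. *)
Lemma test_orthogonal_itv h L c d : locally_integrable `]0, L[ h ->
  (forall f, test_function L f -> (exists c d, [/\ 0 < c, d < L &
      forall x, x \notin `[c, d] -> f x = 0]) ->
    \int[mu]_(x in `]0, L[) (h x * f x) = 0) ->
  0 < c -> c < d -> d < L -> \int[mu]_(x in `]c, d[) h x = 0.
Proof.
move=> lh h0 c0 cd dL.
have [b [b' [bb' b'c bpos b0 bout]]] := C1_bump cd.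
pose f (n : nat) x := n%:R * b x / (1 + n%:R * b x).
pose f' (n : nat) x := n%:R * b' x / (1 + n%:R * b x) ^+ 2.
have den n x : 0 < 1 + n%:R * b x by rewrite ltr_pwDl// mulr_ge0.
have f01 n x : 0 <= f n x <= 1.
  rewrite /f divr_ge0 ?mulr_ge0 ?(ltW (den _ _))//= ler_pdivrMr// mul1r.
  by rewrite lerDr.
have ff' n (x : R) : is_derive x 1 (f n) (f' n x).
  have dn0 : 1 + n%:R * b x != 0 by rewrite gt_eqF.
  have db := bb' x.
  rewrite /f /f'.
  have H1 : is_derive x 1 (fun x => n%:R * b x) (n%:R * b' x).
    apply: (is_derive_eq (is_deriveM (is_derive_cst (n%:R : R) x 1) db)).
    by rewrite scaler0 addr0.
  have H2 : is_derive x 1 (fun x => 1 + n%:R * b x) (n%:R * b' x).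
    by apply: (is_derive_eq (is_deriveD (is_derive_cst (1 : R) x 1) H1));
      rewrite add0r.
  have H3 := @is_deriveV R (fun x => 1 + n%:R * b x) x _ 1 dn0 H2.
  apply: (is_derive_eq (is_deriveM H1 H3)).
  by rewrite /GRing.scale/=; field.
have bc := is_derive_continuous bb'.
have f'c n : continuous (f' n).
  move=> x; apply: cvgM; first by apply: cvgM; [exact: cvg_cst|exact: b'c].
  apply: cvgV; first by rewrite sqrf_eq0 gt_eqF.
  have H : {for x, continuous (fun x => 1 + n%:R * b x)}.
    apply: cvgD; first exact: cvg_cst.
    by apply: cvgM; [exact: cvg_cst|exact: bc].
  by rewrite expr2; apply: cvgM; exact: H.
have fout n x : x \notin `]c, d[ -> f n x = 0.
  by move=> /bout bx; rewrite /f bx mulr0 mul0r.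
have fout' n x : x \notin `[c, d] -> f n x = 0.
  move=> xcd; apply: fout; apply: contra xcd => /[!in_itv]/= /andP[cx xd].
  by rewrite !ltW.
have sub : `]c, d[%classic `<=` `]0, L[.
  move=> x /=; rewrite !in_itv/= => /andP[cx xd].
  by rewrite (lt_trans c0)// (lt_trans xd).
have ih : mu.-integrable `]c, d[ (EFin \o h).
  apply: integrableS (locally_integrable_segment lh c0 dL) => //.
  exact: subset_itv_oo_cc.
have int0 n : (\int[mu]_(x in `]c, d[) (h x * f n x)%:E)%E = 0%E.
  have tf : test_function L (f n) :=
    test_function_of_support c0 dL (ff' n) (f'c n) (fout' n).
  have := h0 _ tf (ex_intro _ c (ex_intro _ d (And3 c0 dL (fout' n)))).
  have : `]c, d[ `&` `]0, L[ = `]c, d[%classic by exact: setIidl.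
  move=> <-; rewrite /Rintegral integral_mkcondl => H.
  have {}H : fine (\int[mu]_(x in `]0, L[) (((fun x => (h x * f n x)%:E) \_ `]c,
    d[) x)) = 0.
    rewrite -[RHS]H; congr fine; apply: eq_integral => x _; rewrite patchE.
    case: ifPn => //; rewrite notin_setE/= => /negP /fout ->.
    by rewrite mulr0.
  (* [fine] also sends infinite values to 0, so finiteness is needed before the extended integral
     itself can be said to vanish. *)
  have /integrable_fin_num : mu.-integrable `]0,
    L[ ((fun x => (h x * f n x)%:E) \_ `]c, d[).
    rewrite -integrable_restrict//.
    have -> : `]0, L[ `&` `]c, d[ = `]c, d[%classic by exact: setIidr.
    apply: integrableS (test_function_mul_integrable lh tf) => //.
  by move=> /(_ (measurable_itv _))/fineK <-; rewrite H.
have cvg : (fun n => \int[mu]_(x in `]c, d[) (h x * f n x)%:E)%E @ \oo -->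
    (\int[mu]_(x in `]c, d[) (h x)%:E)%E.
  have H := @dominated_cvg _ (measurableTypeR R) R mu `]c, d[ (measurable_itv _)
    (fun n x => (h x * f n x)%:E) (fun x => (h x)%:E) (fun x => `|(h x)%:E|%E).
  apply: H => //.
  - move=> n; apply/measurable_EFinP; apply: measurable_funM.
      by apply/measurable_EFinP; exact: measurable_int ih.
    apply: measurable_funTS; apply: continuous_measurable_fun.
    exact: is_derive_continuous (ff' n).
  - move=> x xcd; apply: cvg_EFin; first by near=> n.
    rewrite -[X in _ --> X]mulr1; apply: cvgM; first exact: cvg_cst.
    have bx : 0 < b x by apply: bpos.
    apply/cvgrPdist_lt => e e0; near=> n.
    have -> : 1 - f n x = (1 + n%:R * b x)^-1.
      by rewrite /f; field; rewrite gt_eqF.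
    rewrite ger0_norm ?invr_ge0 ?ltW// -[ltRHS]invrK ltf_pV2 ?posrE ?invr_gt0//.
    rewrite ltr_pwDl// -ler_pdivrMr//; near: n; exact: nbhs_infty_ger.
  - exact: integrable_abse.
  - move=> n x _ /=; rewrite lee_fin normrM ler_piMr//.
    by have /andP[f0 f1] := f01 n x; rewrite ger0_norm.
rewrite /Rintegral; suff -> : (\int[mu]_(x in `]c, d[) (h x)%:E)%E = 0%E by [].
apply/esym; apply: cvg_unique cvg => //; rewrite (_ : (fun n => _) = cst 0%E).
  exact: cvg_cst.
by apply/funext => n; rewrite int0.
Unshelve. all: by end_near. Qed.

(** By Lebesgue differentiation, [h] is almost everywhere the derivative of its primitive, which is
    constant because the integrals over intervals vanish. Truncating to [[1/(n+1), L - 1/(n+1)]]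
    makes [h] integrable, and the countably many null sets are united. Asking for an explicit
    support interval weakens the hypothesis and serves the proof of [weak_deriv0_constant]. *)
Lemma test_orthogonal_ae0 h L : locally_integrable `]0, L[ h ->
  (forall f, test_function L f -> (exists c d, [/\ 0 < c, d < L &
      forall x, x \notin `[c, d] -> f x = 0]) ->
    \int[mu]_(x in `]0, L[) (h x * f x) = 0) ->
  {ae mu, forall x, x \in `]0, L[ -> h x = 0}.
Proof.
move=> lh h0.
have H (n : nat) : {ae mu, forall x, n.+1%:R^-1 < x -> x < L - n.+1%:R^-1 ->
  h x = 0}.
  set c : R := n.+1%:R^-1; set d := L - c.
  have c0 : 0 < c by rewrite invr_gt0.
  have dL : d < L by rewrite ltrBlDr ltrDl.
  pose f := h \_ `[c, d].
  have ih := locally_integrable_segment lh c0 dL.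
  have locf : locally_integrable setT f by exact: integrable_locally.
  have intf y : mu.-integrable `]c, y] (EFin \o f).
    have -> : EFin \o f = (EFin \o h) \_ `[c, d].
      by apply/funext => x; rewrite /f /= !patchE; case: ifPn.
    rewrite -integrable_restrict//; apply: integrableS ih => //.
    exact: measurableI.
  have := FTC1 intf locf.
  apply: filterS; first exact: (ae_filter_ringOfSetsType mu).
  move=> x /= H cx xd; have [|_] := H; first by [].
  have <- : f x = h x.
    by rewrite /f patchE mem_set//= in_itv/= !ltW.
  move=> <-; rewrite derive1E -(@derive_cst R R R (0 : R) x 1).
  apply: near_eq_derive; near=> y.
  have cy : c < y by near: y; exact: lt_nbhsr.
  have yd : y < d by near: y; exact: lt_nbhsl.
  rewrite -[RHS](test_orthogonal_itv lh h0 c0 cy (lt_trans yd dL)).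
  rewrite -Rintegral_itv_bndo_bndc.
    apply: eq_Rintegral => z; rewrite inE/= in_itv/= => /andP[cz zy].
    by rewrite /f patchE mem_set//= in_itv/= !ltW// (lt_trans zy).
  apply: integrableS (intf y) => //; exact: subset_itv_oo_oc.
have := ae_foralln H; apply: filterS => x /= Hx.
rewrite in_itv/= => /andP[x0 xL].
have xm : 0 < Num.min x (L - x) by rewrite lt_min x0 subr_gt0.
have [n _ /(_ _ (leqnn _))/=] := near_infty_natSinv_lt (PosNum xm).
rewrite lt_min => /andP[nx nL]; apply: (Hx n) => //.
by rewrite ltrBrDr addrC -ltrBrDr.
Unshelve. all: by end_near. Qed.

End DuBoisReymond.

(** * Weak derivatives of scalar functions *)

Section WeakDerivative.
Context {R : realType}.
Local Notation mu := (@lebesgue_measure R).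
Implicit Types (f g h u v w F : R -> R) (a b c d e k l m x L : R).

Lemma ae_imply (P Q : R -> Prop) : (forall x, P x -> Q x) ->
  {ae mu, forall x, P x} -> {ae mu, forall x, Q x}.
Proof.
by move=> PQ; apply: filterS => //; exact: (ae_filter_ringOfSetsType mu).
Qed.

Lemma integrable_cmul (D : set R) k f : measurable D ->
  mu.-integrable D (EFin \o f) -> mu.-integrable D (EFin \o (fun x => k * f x)).
Proof.
move=> mD fi; have -> : EFin \o (fun x => k * f x) =
  (fun x => k%:E * (EFin \o f) x)%E.
  by apply/funext => x; rewrite /= EFinM.
exact: integrableZl.
Qed.

(** One coordinate of [weak_derivative], in a form convertible with it. *)
Definition weak_deriv L u g : Prop :=
  [/\ locally_integrable `]0, L[ u, locally_integrable `]0, L[ g &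
    forall phi, test_function L phi ->
      \int[mu]_(s in `]0, L[) (u s * derive1 phi s) =
      - \int[mu]_(s in `]0, L[) (g s * phi s)].

Lemma test_function_continuous L f : test_function L f -> continuous f.
Proof.
by move=> [df _ _ _] x; apply/differentiable_continuous/derivable1_diffP.
Qed.

Lemma weak_derivD L u v g h : weak_deriv L u g -> weak_deriv L v h ->
  weak_deriv L (u \+ v) (g \+ h).
Proof.
move=> [lu lg ug] [lv lh vh]; split; [exact: locally_integrableD..|].
move=> f tf.
under eq_Rintegral do rewrite /= mulrDl.
under [in RHS]eq_Rintegral do rewrite /= mulrDl.
rewrite !RintegralD ?ug ?vh ?opprD//.
all: by [exact: test_function_mul_integrable |
         exact: test_function_mul_derive_integrable].
Qed.

Lemma weak_derivB L u v g h : weak_deriv L u g -> weak_deriv L v h ->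
  weak_deriv L (u \- v) (g \- h).
Proof.
move=> [lu lg ug] [lv lh vh]; split; [exact: locally_integrableB..|].
move=> f tf.
under eq_Rintegral do rewrite /= mulrBl.
under [in RHS]eq_Rintegral do rewrite /= mulrBl.
rewrite !RintegralB ?ug ?vh ?opprD//.
all: by [exact: test_function_mul_integrable |
         exact: test_function_mul_derive_integrable].
Qed.

Lemma weak_deriv_unique L u g h : weak_deriv L u g -> weak_deriv L u h ->
  {ae mu, forall x, x \in `]0, L[ -> g x = h x}.
Proof.
move=> [lu lg ug] [_ lh uh].
have : {ae mu, forall x, x \in `]0, L[ -> (g \- h) x = 0}.
  apply: test_orthogonal_ae0; first exact: locally_integrableB.
  move=> f tf _; under eq_Rintegral do rewrite /= mulrBl.
  rewrite RintegralB//; [|exact: test_function_mul_integrable..].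
  by apply/eqP; rewrite subr_eq0 -eqr_opp -ug// uh.
by apply: ae_imply => x H /H /eqP; rewrite subr_eq0 => /eqP.
Qed.

Lemma locally_integrable_ae_eq_Rintegral L u v f : continuous f ->
  locally_integrable `]0, L[ u -> locally_integrable `]0, L[ v ->
  {ae mu, forall x, x \in `]0, L[ -> u x = v x} ->
  \int[mu]_(s in `]0, L[) (u s * f s) = \int[mu]_(s in `]0, L[) (v s * f s).
Proof.
move=> fc [mu_ _ _] [mv _ _] uv; rewrite /Rintegral; congr fine.
apply: ae_eq_integral => //.
- apply/measurable_EFinP; apply: measurable_funM => //.
  by apply: measurable_funTS; exact: continuous_measurable_fun.
- apply/measurable_EFinP; apply: measurable_funM => //.
  by apply: measurable_funTS; exact: continuous_measurable_fun.
- by move: uv; apply: ae_imply => x H Dx; rewrite H.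
Qed.

Lemma weak_deriv_ael L u v g : locally_integrable `]0, L[ v ->
  {ae mu, forall x, x \in `]0, L[ -> u x = v x} ->
  weak_deriv L u g -> weak_deriv L v g.
Proof.
move=> lv uv [lu lg ug]; split => // f tf; rewrite -ug//.
apply/esym/locally_integrable_ae_eq_Rintegral => //.
by case: tf.
Qed.

Lemma weak_deriv_aer L u g h : locally_integrable `]0, L[ h ->
  {ae mu, forall x, x \in `]0, L[ -> g x = h x} ->
  weak_deriv L u g -> weak_deriv L u h.
Proof.
move=> lh gh [lu lg ug]; split => // f tf; rewrite ug//; congr (- _).
apply: locally_integrable_ae_eq_Rintegral => //.
exact: test_function_continuous tf.
Qed.

Lemma locally_integrable_patch L c d f : continuous f ->
  locally_integrable `]0, L[ (f \_ `[c, d]).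
Proof.
move=> fc; apply: open_integrable_locally; first exact: interval_open.
have -> : EFin \o (f \_ `[c, d]) = (EFin \o f) \_ `[c, d].
  by apply/funext => x /=; rewrite !patchE; case: ifPn.
rewrite -integrable_restrict//.
apply: integrableS (continuous_integrable c d fc) => //.
exact: measurableI.
Qed.

(* The boundary terms vanish because either the test function or [u] does. *)
Lemma weak_deriv_patch L c d u g : 0 <= c -> c < d -> d <= L ->
  (forall x : R, is_derive x 1 u (g x)) -> continuous g ->
  (c = 0) \/ (u c = 0) -> (d = L) \/ (u d = 0) ->
  weak_deriv L (u \_ `[c, d]) (g \_ `[c, d]).
Proof.
move=> c0 cd dL ug gc uc ud.
have ucont := is_derive_continuous ug.
split; [exact: locally_integrable_patch..|] => f tf.
have [K [cK KL f0 f'0]] := test_function_support tf.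
have f00 x : x \notin `]0, L[ -> f x = 0.
  by move=> xL; apply: f0 => /KL /=; apply/negP.
have f'00 x : x \notin `]0, L[ -> derive1 f x = 0.
  by move=> xL; apply: f'0 => /KL /=; apply/negP.
have E (p q : R -> R) : (forall x, x \notin `]0, L[ -> q x = 0) ->
    \int[mu]_(s in `]0, L[) ((p \_ `[c, d]) s * q s) =
    \int[mu]_(s in `[c, d]) (p s * q s).
  move=> q0; rewrite Rintegral_mkcond [RHS]Rintegral_mkcond.
  congr (Rintegral _ _ _); apply/funext => x; rewrite !patchE.
  case: ifPn; case: ifPn => //.
  - by rewrite mul0r.
  - by rewrite !notin_setE/= => _ /negP/q0 ->; rewrite mulr0.
rewrite !E//.
have dfc : continuous (derive1 f) by case: tf.
have df x : is_derive x 1 f (derive1 f x).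
  apply: DeriveDef; last by rewrite derive1E.
  by case: tf.
rewrite (@Rintegration_by_parts R u f g (derive1 f) c d)//.
- have -> : u d * f d = 0.
    case: ud => [->|->]; last by rewrite mul0r.
    by rewrite f00 ?mulr0// in_itv/= ltxx andbF.
  have -> : u c * f c = 0.
    case: uc => [->|->]; last by rewrite mul0r.
    by rewrite f00 ?mulr0// in_itv/= ltxx.
  by rewrite subr0 sub0r.
- exact: continuous_subspaceT.
- exact: is_derive_LRcontinuous ug.
- by move=> x _; exact: is_derive1E.
- exact: continuous_subspaceT.
- exact: is_derive_LRcontinuous df.
Qed.

Lemma ae_exists_itv (P : R -> Prop) a b : a < b -> {ae mu, forall x, P x} ->
  exists2 x, x \in `]a, b[ & P x.
Proof.
move=> ab [A [mA A0 PA]]; apply/not_exists2P => H.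
have : (mu `]a, b[ <= mu A)%E.
  apply: le_measure; rewrite ?inE//.
  by move=> x /= xab; apply: PA => /= Px; have [] := H x.
by rewrite A0 lebesgue_measure_itv/= lte_fin ab -EFinD lee_fin subr_le0 leNgt
  ab.
Qed.

Lemma continuous_ae_eq L u v : 0 < L -> {within `[0, L], continuous u} ->
  {within `[0, L], continuous v} ->
  {ae mu, forall x, x \in `]0, L[ -> u x = v x} ->
  forall x, x \in `[0, L] -> u x = v x.
Proof.
move=> L0 cu cv uv x xL; apply/eqP/negPn/negP; rewrite -subr_eq0 => uvx.
have uvx0 : 0 < `|u x - v x| by rewrite normr_gt0.
have : u y - v y @[y --> within `[0, L] (nbhs x)] --> u x - v x.
  by apply: cvgB; [move/subspace_continuousP: cu|move/subspace_continuousP: cv];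
    exact.
move=> /cvgrPdist_lt/(_ _ uvx0)[e /= e0 He].
have /andP[x0 xL'] : 0 <= x <= L by rewrite in_itv in xL.
(* This interval has positive length even when [x] is an endpoint, so it contains a point where [u]
   and [v] agree, while closeness to [x] forces them to differ. *)
have [|y] := @ae_exists_itv _ (Num.max 0 (x - e)) (Num.min L (x + e)) _ uv.
  rewrite gt_max !lt_min; lra.
rewrite in_itv/= gt_max lt_min => /andP[/andP[y0 xy] /andP[yL yx]].
rewrite in_itv/= y0 yL => /(_ isT) uvy.
have := He y; rewrite uvy subrr subr0 ltxx => H; suff: false by [].
apply: H; first by rewrite /= ltr_norml; lra.
by rewrite /= in_itv/= !ltW.
Qed.

Lemma Rintegral_zero_outside f (A : set R) c d :
  (forall x, x \notin `[c, d] -> f x = 0) -> `[c, d] `<=` A ->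
  \int[mu]_(x in A) f x = \int[mu]_(x in `[c, d]) f x.
Proof.
move=> f0 cdA; rewrite Rintegral_mkcond [RHS]Rintegral_mkcond.
congr (Rintegral _ _ _); apply/funext => x; rewrite !patchE.
case: ifPn => xA; case: ifPn => //.
- by rewrite notin_setE/= => /negP/f0.
- by rewrite inE => /cdA; move: xA; rewrite notin_setE.
Qed.

(** Du Bois-Reymond argument: subtracting a multiple of a fixed bump [B] from a test function gives
    mean zero, hence the derivative of a test function, to which [w] is orthogonal. Thus the
    integral of [w f] is a fixed multiple [k] of the integral of [f]. *)
Lemma weak_deriv0_constant L w : 0 < L -> {within `[0, L], continuous w} ->
  weak_deriv L w (cst 0) ->
  exists k, forall x, x \in `[0, L] -> w x = k.
Proof.
move=> L0 wc [lw _ w0].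
have L3 : L / 3 < 2 * L / 3 by lra.
have L30 : 0 < L / 3 by lra.
have L32 : 2 * L / 3 < L by lra.
have [B [B' [BB' B'c Bpos B0 Bout]]] := C1_bump L3.
have Bc := is_derive_continuous BB'.
have Bout' x : x \notin `[L / 3, 2 * L / 3] -> B x = 0.
  move=> xI; apply: Bout; apply: contra xI => /[!in_itv]/= /andP[cx xd].
  by rewrite !ltW.
have tB := test_function_of_support L30 L32 BB' B'c Bout'.
have subB : `[L / 3, 2 * L / 3] `<=` `]0, L[.
  by move=> x /=; rewrite !in_itv/=; lra.
pose beta := \int[mu]_(x in `]0, L[) B x.
have beta0 : 0 < beta.
  rewrite /beta (Rintegral_zero_outside Bout' subB).
  have [Q QB] := continuous_primitive Bc.
  rewrite (continuous_FTC QB)//; last exact: ltW.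
  have [|z zI ->] := @MVT R Q B _ _ L3.
    by apply: continuous_subspaceT; exact: is_derive_continuous QB.
  by rewrite mulr_gt0 ?Bpos ?subr_gt0.
(* The only possible value of the constant: the mean of [w] with weight [B]. *)
pose k := (\int[mu]_(x in `]0, L[) (w x * B x)) / beta.
exists k; apply: continuous_ae_eq => //.
  by apply: continuous_subspaceT => x; exact: cst_continuous.
have lk : locally_integrable `]0, L[ (cst k : R -> R).
  apply: open_integrable_locally; first exact: interval_open.
  apply: integrableS (continuous_integrable 0 L (@cst_continuous _ _ k)) => //.
  exact: subset_itv_oo_cc.
suff : {ae mu, forall x, x \in `]0, L[ -> (w \- cst k) x = 0}.
  by apply: ae_imply => x H /H /eqP; rewrite subr_eq0 => /eqP.
apply: test_orthogonal_ae0; first exact: locally_integrableB.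
move=> f tf [c [d [c0 dL fout]]].
have fc := test_function_continuous tf.
pose m := \int[mu]_(x in `]0, L[) f x.
pose g x := f x - m / beta * B x.
have gc : continuous g.
  move=> x; apply: cvgB; first exact: fc.
  by apply: cvgM; [exact: cvg_cst|exact: Bc].
pose c1 := Num.min c (L / 3); pose d1 := Num.max d (2 * L / 3).
have c10 : 0 < c1 by rewrite /c1 lt_min c0.
have d1L : d1 < L by rewrite /d1 gt_max dL.
have gout x : x \notin `[c1, d1] -> g x = 0.
  move=> xI; rewrite /g fout ?Bout' ?mulr0 ?subr0//; apply: contra xI.
    rewrite !in_itv/= /c1 /d1 ge_min le_max; move=> /andP[-> ->].
    by rewrite !orbT.
  by rewrite !in_itv/= /c1 /d1 ge_min le_max; move=> /andP[-> ->].
have f1 : mu.-integrable `]0, L[ (EFin \o f).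
  apply: integrableS (continuous_integrable 0 L fc) => //.
  exact: subset_itv_oo_cc.
have B1 : mu.-integrable `]0, L[ (EFin \o B).
  apply: integrableS (continuous_integrable 0 L Bc) => //.
  exact: subset_itv_oo_cc.
have mB1 : mu.-integrable `]0, L[ (EFin \o (fun x => m / beta * B x)).
  exact: integrable_cmul.
have gint : \int[mu]_(x in `]0, L[) g x = 0.
  rewrite RintegralB//= RintegralZl//= -/beta -/m.
  by field; rewrite gt_eqF.
have sub1 : `[c1, d1] `<=` `]0, L[.
  by move=> x /=; rewrite !in_itv/= => /andP[cx xd]; rewrite (lt_le_trans c10)//
    (le_lt_trans xd).
have [G Gg] := continuous_primitive gc.
have Gg' x : is_derive x 1 (fun x => G x - G 0) (g x).
  by apply: (is_derive_eq (is_deriveB (Gg x) (is_derive_cst (G 0) x 1)));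
    rewrite subr0.
(* To the left of [c1] nothing has been integrated yet; to the right of [d1] the whole integral of
   [g] has, and it is zero. *)
have Gout x : x \notin `[c1, d1] -> G x - G 0 = 0.
  rewrite in_itv/= negb_and -!ltNge => /orP[xc|dx].
    have [x0|x0] := leP 0 x.
      rewrite -(continuous_FTC Gg gc x0) /Rintegral integral0_eq// => y.
      rewrite /= in_itv/= => /andP[_ yx]; rewrite gout// in_itv/=.
      by rewrite negb_and -ltNge (le_lt_trans yx).
    apply/eqP; rewrite -oppr_eq0 opprB -(continuous_FTC Gg gc (ltW x0));
      apply/eqP.
    rewrite /Rintegral integral0_eq// => y.
    rewrite /= in_itv/= => /andP[_ yx]; rewrite gout// in_itv/=.
    by rewrite negb_and -ltNge (le_lt_trans yx).
  have cd1 : c1 <= d1 by rewrite /c1 /d1 ge_min !le_max; apply/orP; right;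
    apply/orP; right; lra.
  have x0 : 0 <= x by rewrite (le_trans (ltW c10))// (le_trans cd1)// ltW.
  rewrite -(continuous_FTC Gg gc x0) (Rintegral_zero_outside gout).
    by rewrite -(Rintegral_zero_outside gout sub1).
  move=> y /=; rewrite !in_itv/= => /andP[cy yd].
  by rewrite (le_trans (ltW c10))// (le_trans yd)// ltW.
have tG := test_function_of_support c10 d1L Gg' gc Gout.
have := w0 _ tG.
have -> : derive1 (fun x => G x - G 0) = g.
  by apply/funext => x; exact: is_derive1E.
rewrite [X in _ = - X](_ : _ = 0); last first.
  by rewrite /Rintegral integral0_eq// => y _; rewrite mul0r.
rewrite oppr0 => H; rewrite -[RHS]H.
under eq_Rintegral do rewrite /= mulrBl.
under [in RHS]eq_Rintegral do rewrite /g mulrBr mulrCA.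
have wB := test_function_mul_integrable lw tB.
have wf := test_function_mul_integrable lw tf.
rewrite RintegralB//; last exact: test_function_mul_integrable lk tf.
rewrite [RHS]RintegralB//; last exact: integrable_cmul.
rewrite !RintegralZl//= -/m /k; congr (_ - _).
by field; rewrite gt_eqF.
Qed.

(** The retraction onto [[0, L]]: composing with it extends a function continuous on the segment to
    one continuous on the line, which then has a primitive there. *)
Definition clamp L x : R := Num.max 0 (Num.min L x).

Lemma clamp_in L x : 0 <= L -> clamp L x \in `[0, L].
Proof. by move=> L0; rewrite in_itv/= /clamp le_max lexx ge_max L0 ge_min lexx.
  Qed.

Lemma clamp_id L x : x \in `[0, L] -> clamp L x = x.
Proof. by rewrite in_itv/= => /andP[x0 xL]; rewrite /clamp min_r// max_r. Qed.

Lemma continuous_clamp L g : 0 <= L -> {within `[0, L], continuous g} ->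
  continuous (g \o clamp L).
Proof.
move=> L0 /subspace_continuousP gc x.
have cc : continuous (clamp L).
  move=> y; apply: continuous_max; first exact: cst_continuous.
  by apply: continuous_min; [exact: cst_continuous|exact: cvg_id].
have /gc H : `[0, L]%classic (clamp L x) by exact: clamp_in.
apply: cvg_comp H => P HP.
have H2 : \forall y \near x, `[0, L]%classic (clamp L y) -> P (clamp L y) :=
  cc x _ HP.
by apply: filterS H2 => y; apply; exact: clamp_in.
Qed.

(** A classical primitive [G] of the extension of [g] has the same weak derivative as [u], so
    [u - G] is constant and [u] inherits the differentiability of [G]. *)
Lemma weak_deriv_is_derive L u g : 0 < L -> {within `[0, L], continuous u} ->
  {within `[0, L], continuous g} -> weak_deriv L u g ->
  forall x, x \in `]0, L[ -> is_derive x 1 u (g x).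
Proof.
move=> L0 cu cg ug.
have gc := continuous_clamp (ltW L0) cg.
have [G Gg] := continuous_primitive gc.
have Gc := is_derive_continuous Gg.
have patch_ae (f h : R -> R) : (forall x, x \in `]0, L[ -> f x = h x) ->
    {ae mu, forall x, x \in `]0, L[ -> (f \_ `[0, L]) x = h x}.
  move=> fh; apply: aeW => x xL; rewrite patchE mem_set ?fh//.
  exact: subset_itv_oo_cc.
have [k uGk] : exists k, forall x, x \in `[0, L] -> (u \- G) x = k.
  apply: weak_deriv0_constant => //.
    apply/subspace_continuousP => x xL; apply: cvgB.
      by move/subspace_continuousP : cu; exact.
    by apply: cvg_within_filter; exact: Gc.
  (* With the patch equal to all of [[0, L]] the boundary terms are killed by the test function,
     whatever the end values of [G]. *)
  have H := weak_derivB ug (weak_deriv_patch (lexx 0) L0 (lexx L) Gg gc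
    (or_introl erefl) (or_introl erefl)).
  have lu : locally_integrable `]0, L[ u by case: ug.
  have lG : locally_integrable `]0, L[ G.
    apply: open_integrable_locally; first exact: interval_open.
    apply: integrableS (continuous_integrable 0 L Gc) => //.
    exact: subset_itv_oo_cc.
  apply: weak_deriv_ael (weak_deriv_aer _ _ H).
  - exact: locally_integrableB.
  - have := patch_ae G G (fun _ _ => erefl); apply: ae_imply => x Hx xL.
    by rewrite /= Hx.
  - apply: open_integrable_locally; first exact: interval_open.
    apply: integrableS (continuous_integrable 0 L (@cst_continuous _ _ 0)) =>
      //.
    exact: subset_itv_oo_cc.
  - have := patch_ae (g \o clamp L) (g \o clamp L) (fun _ _ => erefl).
    apply: ae_imply => x Hx xL.
    by rewrite /= Hx//= clamp_id ?subrr//; exact: subset_itv_oo_cc.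
move=> x xL.
have Gx : is_derive x 1 (fun x => G x + k) (g x).
  apply: (is_derive_eq (is_deriveD (Gg x) (is_derive_cst k x 1))).
  by rewrite addr0 /= clamp_id//; exact: subset_itv_oo_cc.
apply: near_eq_is_derive Gx; near=> y.
have yL : y \in `]0, L[ by near: y; exact: near_in_itvoo.
by rewrite -(uGk y) ?subrKC//; exact: subset_itv_oo_cc.
Unshelve. all: by end_near. Qed.

End WeakDerivative.

(** * Periodic integrals and Lp norms *)

Section PeriodicIntegral.
Context {R : realType}.
Local Notation mu := (@lebesgue_measure R).
Implicit Types (f : R -> \bar R) (a b c d e k l m x y L h P : R).

Local Notation borelR := (measurableTypeR R).

Lemma measurable_shift h :
  measurable_fun [set: borelR] (fun x : borelR => x + h : borelR).
Proof. exact: measurable_funD. Qed.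

Definition shift_mfun h : {mfun borelR >-> borelR} :=
  @mfun_Sub _ _ borelR borelR _ (mem_set (measurable_shift h)).

(** The pushforward by the translation gives half-open intervals their length, and Lebesgue measure
    is the only measure that does. *)
Lemma lebesgue_measure_shift h (A : set R) : measurable A ->
  mu ((fun x => x + h) @^-1` A) = mu A.
Proof.
move=> mA; pose phi := shift_mfun h.
have H (X : set R) : ocitv X -> mu X = pushforward mu phi X.
  case=> -[x y] _ <-; rewrite /pushforward /=.
  have -> : phi @^-1` `]x, y] = `](x - h), (y - h)]%classic.
    by apply/seteqP; split => z /=; rewrite !in_itv/= ltrBlDr lerBrDr.
  rewrite !lebesgue_measure_itv/= !lte_fin ltrD2r -!EFinB.
  by case: ifP => // _; congr EFin; ring.
by rewrite (@lebesgue_measure_unique R (pushforward mu phi) H A mA).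
Qed.

Lemma integral_shift f h a b : measurable_fun setT f -> (forall x,
  (0 <= f x)%E) ->
  (\int[mu]_(x in `]a, b]) f (x + h)%R = \int[mu]_(x in `](a + h)%R, (b +
    h)%R]) f x)%E.
Proof.
move=> mf f0.
pose phi := shift_mfun h.
have H : (\int[mu]_(x in `](a + h)%R, (b + h)%R]) f x =
    \int[pushforward mu phi]_(x in `](a + h)%R, (b + h)%R]) f x)%E.
  apply: eq_measure_integral => A mA _.
  exact/esym/(lebesgue_measure_shift h mA).
rewrite H ge0_integral_pushforward//; last exact: measurable_funTS.
have -> : phi @^-1` `]a + h, b + h] = `]a, b]%classic; last by [].
by apply/seteqP; split => z /=; rewrite !in_itv/= ltrD2r lerD2r.
Qed.

Lemma integral_itv_cat f a b c : measurable_fun setT f -> (forall x,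
  (0 <= f x)%E) ->
  a <= b -> b <= c ->
  (\int[mu]_(x in `]a, c]) f x = \int[mu]_(x in `]a, b]) f x +
    \int[mu]_(x in `]b, c]) f x)%E.
Proof.
move=> mf f0 ab bc; rewrite (@itv_bndbnd_setU _ _ _ (BRight b)) ?bnd_simp//.
rewrite ge0_integral_setU//; first exact: measurable_funTS.
by apply/disj_setPS => y [/=]; rewrite 2!in_itv/= => /andP[_ yx] /andP[];
  rewrite ltNge yx.
Qed.

(** The windows share []y, x + P]], and the remaining pieces are translates by [P]. Pieces are only
    added, never subtracted, so infinite integrals are allowed. *)
Lemma integral_period f P x y : measurable_fun setT f -> (forall x,
  (0 <= f x)%E) ->
  0 < P -> (forall x, f (x + P) = f x) -> x <= y <= x + P ->
  (\int[mu]_(t in `]x, (x + P)%R]) f t = \int[mu]_(t in `]y, (y + P)%R]) f t)%E.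
Proof.
move=> mf f0 P0 fP /andP[xy yx].
rewrite (@integral_itv_cat _ x y)// (@integral_itv_cat _ y (x + P) (y +
  P)) ?lerD2r//.
rewrite -(@integral_shift _ P x y)// addeC; congr (_ + _)%E.
by apply: eq_integral => t _; rewrite fP.
Qed.

Lemma integral_period_shift f P c h : measurable_fun setT f -> (forall x,
  (0 <= f x)%E) ->
  0 < P -> (forall x, f (x + P) = f x) -> `|h| <= P ->
  (\int[mu]_(t in `[c, (c + P)%R]) f (t + h)%R = \int[mu]_(t in `[c, (c +
    P)%R]) f t)%E.
Proof.
move=> mf f0 P0 fP hP.
have mfh : measurable_fun setT (fun t : R => f (t + h)).
  by apply: measurableT_comp => //; exact: measurable_funD.
rewrite -!integral_itv_obnd_cbnd; [|exact: measurable_funTS..].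
(* [integral_period] wants the earlier window first, so a negative [h] exchanges the roles of the
   two. *)
rewrite integral_shift// addrAC; case: (leP 0 h) => h0.
  apply/esym/integral_period => //; rewrite lerDl h0 lerD2l.
  by rewrite (le_trans _ hP)// ler_norm.
apply/integral_period => //; rewrite gerDl ltW//= addrAC.
rewrite -[leLHS]addr0 -addrA lerD2l; move: hP; rewrite ltr0_norm//; lra.
Qed.

End PeriodicIntegral.

Section LpNorm.
Context {R : realType}.
Local Notation mu := (@lebesgue_measure R).
Implicit Types (p L M : R) (f g : R -> R).

Lemma Lnorm_ae_le p f g : 0 < p -> measurable_fun setT f ->
  measurable_fun setT g ->
  {ae mu, forall x, `|f x| <= `|g x|} ->
  ('N[mu]_p%:E[EFin \o f] <= 'N[mu]_p%:E[EFin \o g])%E.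
Proof.
move=> p0 mf mg fg; rewrite unlock /Lnorm.
have I0 (h : R -> R) : (0 <= \int[mu]_x `|(EFin \o h) x| `^ p)%E.
  by apply: integral_ge0 => x _; exact: poweR_ge0.
have mI (h : R -> R) : measurable_fun setT h ->
    measurable_fun setT (fun x => (`|(EFin \o h) x| `^ p)%E).
  move=> mh; apply: (measurableT_comp (measurable_poweR p)).
  by apply: measurableT_comp => //; exact/measurable_EFinP.
have inI h : (\int[mu]_x `|(EFin \o h) x| `^ p)%E \in `[0, +oo%E]%R.
  by rewrite in_itv/= I0 leey.
apply: gt0_ler_poweR; [by rewrite invr_ge0 ltW|exact: inI|exact: inI|].
apply: ae_ge0_le_integral => //; first by move=> x _; exact: poweR_ge0.
- exact: mI.
- by move=> x _; exact: poweR_ge0.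
- exact: mI.
- move: fg; apply: ae_imply => x fgx _ /=.
  rewrite lee_fin; apply: ge0_ler_powR => //.
  exact: ltW.
Qed.

Lemma Lnorm_cst_patch p L M : 0 < p -> 0 <= L -> 0 <= M ->
  ('N[mu]_p%:E[EFin \o (cst M \_ `]0%R, L[)] = (M * (L `^ p^-1))%R%:E)%E.
Proof.
move=> p0 L0 M0; rewrite unlock /Lnorm.
have -> : (fun x => (`|(EFin \o (cst M \_ `]0%R, L[)) x| `^ p)%E) =
    (cst ((M `^ p)%:E)) \_ `]0, L[.
  apply/funext => x; rewrite /= !patchE; case: ifPn => _.
    by rewrite ger0_norm.
  by rewrite normr0 powR0// gt_eqF.
rewrite -integral_mkcond integral_cst//= lebesgue_measure_itv/= lte_fin.
case: ltgtP L0 => // [L0 _|<- _].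
  rewrite -EFinB -EFinM poweR_EFin subr0 powRM ?powR_ge0 ?(ltW L0)//
    -powRrM divff ?gt_eqF//.
  by rewrite powRr1.
by rewrite mule0 poweR_EFin !powR0 ?mulr0// invr_neq0// gt_eqF.
Qed.

End LpNorm.

(** * Plane curves *)

Lemma ord2P (P : 'I_2 -> Prop) : P ord0 -> P ord_max -> forall i, P i.
Proof.
by move=> P0 P1 [[|[|//]] i2]; [rewrite (_ : Ordinal i2 = ord0)|
  rewrite (_ : Ordinal i2 = ord_max)] => //; exact: val_inj.
Qed.

Section PlaneNorm.
Context {R : realType}.
Implicit Types (u v : 'rV[R]_2).

Lemma rV2P u v : u ord0 ord0 = v ord0 ord0 -> u ord0 ord_max = v ord0 ord_max ->
  u = v.
Proof. by move=> uv0 uv1; apply/rowP; exact: ord2P. Qed.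

Lemma enorm_ge0 u : 0 <= enorm u. Proof. exact: sqrtr_ge0. Qed.

Lemma enorm_sqr u : enorm u ^+ 2 = u ord0 ord0 ^+ 2 + u ord0 ord_max ^+ 2.
Proof. by rewrite sqr_sqrtr// addr_ge0// sqr_ge0. Qed.

Lemma enormD u v : enorm (u + v) <= enorm u + enorm v.
Proof.
rewrite -ler_sqr ?nnegrE ?addr_ge0 ?enorm_ge0// sqrrD !enorm_sqr !mxE.
move: (u ord0 ord0) (u ord0 ord_max) (v ord0 ord0) (v ord0 ord_max)
  (enorm_sqr u) (enorm_sqr v) (enorm_ge0 u) (enorm_ge0 v).
move: (enorm u) (enorm v) => p q a b c d pE qE p0 q0.
(* What remains is the Cauchy-Schwarz inequality, obtained below from Lagrange's identity. *)
suff : a * c + b * d <= p * q by rewrite -mulr_natr; nra.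
apply: le_trans (ler_norm _) _; rewrite -ler_sqr ?nnegrE ?mulr_ge0 ?normr_ge0//.
rewrite real_normK ?num_real// exprMn pE qE -subr_ge0.
have -> : (a ^+ 2 + b ^+ 2) * (c ^+ 2 + d ^+ 2) - (a * c + b * d) ^+ 2 =
  (a * d - b * c) ^+ 2 by ring.
exact: sqr_ge0.
Qed.

Lemma enorm_le u e : `|u ord0 ord0| <= e -> `|u ord0 ord_max| <= e ->
  enorm u <= e + e.
Proof.
move=> u0 u1; have e0 : 0 <= e := le_trans (normr_ge0 _) u0.
rewrite -ler_sqr ?nnegrE ?addr_ge0 ?enorm_ge0// enorm_sqr.
by rewrite -(real_normK (num_real (u ord0 ord0))) -(real_normK (num_real (u ord0
  ord_max)));
  have := normr_ge0 (u ord0 ord0); have := normr_ge0 (u ord0 ord_max); nra.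
Qed.

End PlaneNorm.

Section Curves.
Context {R : realType}.
Local Notation mu := (@lebesgue_measure R).
Local Notation curve := (R -> 'rV[R]_2).
Implicit Types (L p : R) (u v w g h : curve).

Lemma ae_imply2 (P Q S : R -> Prop) : (forall x, P x -> Q x -> S x) ->
  {ae mu, forall x, P x} -> {ae mu, forall x, Q x} -> {ae mu, forall x, S x}.
Proof.
move=> PQS; exact: (@filterS2 _ _ (ae_filter_ringOfSetsType mu) _ _ _ PQS).
Qed.

Lemma ae_rV2 L u v :
  (forall i, {ae mu, forall x, x \in `]0, L[ -> u x ord0 i = v x ord0 i}) ->
  {ae mu, forall x, x \in `]0, L[ -> u x = v x}.
Proof.
by move=> uv; apply: ae_imply2 (uv ord0) (uv ord_max) => x H0 H1 xL;
  apply: rV2P; [exact: H0|exact: H1].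
Qed.

Lemma weak_derivativeB L u v g h : weak_derivative L u g ->
  weak_derivative L v h -> weak_derivative L (u \- v) (g \- h).
Proof.
move=> ug vh i; have H := weak_derivB (ug i) (vh i).
rewrite -/(weak_deriv L (fun s => (u \- v) s ord0 i) (fun s => (g \- h) s ord0
  i)).
have E (a b : curve) : (fun s => (a \- b) s ord0 i) =
    (fun s => a s ord0 i) \- (fun s => b s ord0 i).
  by apply/funext => s; rewrite /= !mxE.
by rewrite !E.
Qed.

Lemma weak_derivativeD L u v g h : weak_derivative L u g ->
  weak_derivative L v h -> weak_derivative L (u \+ v) (g \+ h).
Proof.
move=> ug vh i; have H := weak_derivD (ug i) (vh i).
rewrite -/(weak_deriv L (fun s => (u \+ v) s ord0 i) (fun s => (g \+ h) s ord0
  i)).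
have E (a b : curve) : (fun s => (a \+ b) s ord0 i) =
    (fun s => a s ord0 i) \+ (fun s => b s ord0 i).
  by apply/funext => s; rewrite /= !mxE.
by rewrite !E.
Qed.

Lemma weak_derivative_unique L u g h : weak_derivative L u g ->
  weak_derivative L u h -> {ae mu, forall x, x \in `]0, L[ -> g x = h x}.
Proof.
by move=> ug uh; apply: ae_rV2 => i; exact: weak_deriv_unique (ug i) (uh i).
Qed.

Lemma weak_derivative_ael L u v g :
  (forall i, locally_integrable `]0, L[ (fun s => v s ord0 i)) ->
  {ae mu, forall x, x \in `]0, L[ -> u x = v x} ->
  weak_derivative L u g -> weak_derivative L v g.
Proof.
move=> lv uv ug i; apply: weak_deriv_ael (ug i) => //.
by move: uv; apply: ae_imply => x H xL; rewrite H.
Qed.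

Lemma weak_derivative_aer L u g h :
  (forall i, locally_integrable `]0, L[ (fun s => h s ord0 i)) ->
  {ae mu, forall x, x \in `]0, L[ -> g x = h x} ->
  weak_derivative L u g -> weak_derivative L u h.
Proof.
move=> lv uv ug i; apply: weak_deriv_aer (ug i) => //.
by move: uv; apply: ae_imply => x H xL; rewrite H.
Qed.

Lemma wderiveP L u g : weak_derivative L u g ->
  weak_derivative L u (wderive L u).
Proof. by move=> ug; exact: (xgetI _ ug). Qed.

Lemma within_continuous_rV2P (A : set R) u :
  {within A, continuous u} <->
  forall i, {within A, continuous (fun s => u s ord0 i)}.
Proof.
split=> [uc i|uc].
  move=> x; apply: (@continuous_comp (subspace A) _ _ u
    (fun M : 'rV[R]_2 => M ord0 i)); first exact: uc.
  exact: coord_continuous.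
move=> x; apply/cvgrPdist_le => /= e e0.
have H i : \forall t \near x, `|u x ord0 i - u t ord0 i| <= e.
  by have /cvgrPdist_le/(_ _ e0) := uc i x.
have H0 := H ord0; have H1 := H ord_max.
near=> t.
rewrite [leLHS]mx_normrE (bigmax_le _ (ltW e0))//= => -[i j] _ /=.
rewrite !mxE (ord1 i).
have t0 : `|u x ord0 ord0 - u t ord0 ord0| <= e by near: t.
have t1 : `|u x ord0 ord_max - u t ord0 ord_max| <= e by near: t.
by move: j; exact: ord2P.
Unshelve. all: by end_near. Qed.

(** Continuous functions that agree almost everywhere agree everywhere; hence exhibiting one
    continuous weak derivative identifies [velocity] at every point, endpoints included. *)
Lemma velocity_unique L u v : 0 < L -> {within `[0, L], continuous v} ->
  weak_derivative L u v ->
  [/\ {within `[0, L], continuous (velocity L u)},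
      weak_derivative L u (velocity L u) &
      forall x, x \in `[0, L] -> velocity L u x = v x].
Proof.
move=> L0 cv uv.
have [c1 d1] : [set v | {within `[0, L], continuous v} /\ weak_derivative L u v]
    (velocity L u) by apply: (@xgetI _ _ _ v).
split => // x xL; apply/rowP => i.
apply: (continuous_ae_eq L0 (u := fun s => velocity L u s ord0 i)
  (v := fun s => v s ord0 i)) => //.
- exact: (within_continuous_rV2P _ _).1.
- exact: (within_continuous_rV2P _ _).1.
- exact: weak_deriv_unique (d1 i) (uv i).
Qed.

(** Were there no continuous weak derivative, [velocity] would be its default value 0, whose norm is
    not 1. *)
Lemma arclength_velocity L u : 0 < L -> arclength L u ->
  {within `[0, L], continuous (velocity L u)} /\
  weak_derivative L u (velocity L u).
Proof.
move=> L0 au; rewrite /velocity; case: xgetP => [v ? []//|none].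
exfalso; have := au 0; rewrite in_itv/= lexx (ltW L0) => /(_ isT).
rewrite /velocity xgetPN; last by move=> v; exact: none.
by rewrite /enorm !mxE expr0n/= addr0 sqrtr0 => /esym/eqP; rewrite oner_eq0.
Qed.

End Curves.

(** * The W^{2,p} norm: independence of representatives and triangle inequality *)

Section SobolevNorm.
Context {R : realType}.
Local Notation mu := (@lebesgue_measure R).
Local Notation curve := (R -> 'rV[R]_2).
Implicit Types (L p M : R) (u v w g h : curve).

Definition coord_measurable L u : Prop :=
  forall i, measurable_fun `]0, L[ (fun s => u s ord0 i).

Lemma weak_derivative_measurable L u g : weak_derivative L u g ->
  coord_measurable L u /\ coord_measurable L g.
Proof. by move=> ug; split => i; have [[mu_ _ _] [mg _ _] _] := ug i. Qed.

Lemma coord_measurableB L u v : coord_measurable L u -> coord_measurable L v ->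
  coord_measurable L (u \- v).
Proof.
move=> mu_ mv i.
have -> : (fun s => (u \- v) s ord0 i) =
    (fun s => u s ord0 i) \- (fun s => v s ord0 i).
  by apply/funext => s; rewrite /= !mxE.
exact: measurable_funB.
Qed.

Lemma measurable_enorm L u : coord_measurable L u ->
  measurable_fun setT ((enorm \o u) \_ `]0, L[).
Proof.
move=> mu_; apply/(measurable_restrictT _ _).1 => //.
have H : measurable_fun `]0, L[
    (fun s => u s ord0 ord0 ^+ 2 + u s ord0 ord_max ^+ 2).
  by apply: measurable_funD; apply: measurable_funX; exact: mu_.
exact: (measurableT_comp (continuous_measurable_fun (@sqrt_continuous R)) H).
Qed.

Lemma Lp_norm_ae_le L p u v : 0 < p -> coord_measurable L u ->
  coord_measurable L v ->
  {ae mu, forall x, x \in `]0, L[ -> enorm (u x) <= enorm (v x)} ->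
  (Lp_norm L p u <= Lp_norm L p v)%E.
Proof.
move=> p0 mu_ mv uv; apply: Lnorm_ae_le => //; [exact: measurable_enorm..|].
move: uv; apply: ae_imply => x uvx; rewrite !patchE.
case: ifPn => //; rewrite inE => /uvx.
by rewrite /= !ger0_norm ?enorm_ge0.
Qed.

Lemma Lp_norm_ae_eq L p u v : 0 < p -> coord_measurable L u ->
  coord_measurable L v -> {ae mu, forall x, x \in `]0, L[ -> u x = v x} ->
  Lp_norm L p u = Lp_norm L p v.
Proof.
move=> p0 mu_ mv uv; apply/eqP; rewrite eq_le; apply/andP; split;
  apply: Lp_norm_ae_le => //; move: uv; apply: ae_imply => x uvx xL;
  by rewrite uvx.
Qed.

Lemma Lp_norm_triangle L p u v w : 1 <= p -> coord_measurable L u ->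
  coord_measurable L v -> coord_measurable L w ->
  (Lp_norm L p (u \- w)%R <= Lp_norm L p (u \- v)%R + Lp_norm L p (v \- w)%R)%E.
Proof.
move=> p1 mu_ mv mw.
have muv := measurable_enorm (coord_measurableB mu_ mv).
have mvw := measurable_enorm (coord_measurableB mv mw).
apply: le_trans (minkowski_EFin mu muv mvw p1).
apply: Lnorm_ae_le; first exact: lt_le_trans p1.
- by apply: measurable_enorm; exact: coord_measurableB.
- exact: measurable_funD.
- apply: aeW => x; rewrite /= !patchE; case: ifPn => _; last by rewrite normr0.
  rewrite !ger0_norm ?addr_ge0 ?enorm_ge0//=.
  have -> : u x - w x = (u x - v x) + (v x - w x) by rewrite addrA subrK.
  exact: enormD.
Qed.

Lemma Lp_norm_bound L p u M : 0 < p -> 0 <= L -> 0 <= M ->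
  coord_measurable L u ->
  (forall x, x \in `]0, L[ -> enorm (u x) <= M) ->
  (Lp_norm L p u <= (M * (L `^ p^-1))%:E)%E.
Proof.
move=> p0 L0 M0 mu_ uM; rewrite -Lnorm_cst_patch//.
apply: Lnorm_ae_le => //; first exact: measurable_enorm.
  exact/(measurable_restrictT _ _).1.
apply: aeW => x; rewrite !patchE; case: ifPn => //; rewrite inE => /uM.
by rewrite /= !ger0_norm ?enorm_ge0.
Qed.

(** [W2p_norm] is computed on chosen derivatives; almost everywhere uniqueness, used once for each
    order, replaces them by any explicit ones. *)
Lemma W2p_normE L p u g h : 0 < p -> weak_derivative L u g ->
  weak_derivative L g h ->
  W2p_norm L p u = (Lp_norm L p u + Lp_norm L p g + Lp_norm L p h)%E.
Proof.
move=> p0 ug gh; rewrite /W2p_norm.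
have ug' := wderiveP ug.
have gg' := weak_derivative_unique ug ug'.
have lg' i : locally_integrable `]0, L[ (fun s => wderive L u s ord0 i).
  by have [] := ug' i.
have g'h := weak_derivative_ael lg' gg' gh.
have g'h' := wderiveP g'h.
have hh' := weak_derivative_unique g'h g'h'.
have [_ mg] := weak_derivative_measurable ug.
have [mg' mh] := weak_derivative_measurable g'h.
have [_ mh'] := weak_derivative_measurable g'h'.
by rewrite -(Lp_norm_ae_eq p0 mg mg' gg') -(Lp_norm_ae_eq p0 mh mh' hh').
Qed.

Lemma W2p_norm_triangle L p u v w : 1 <= p -> W2p L p u -> W2p L p v ->
  W2p L p w ->
  (W2p_norm L p (u \- w)%R <= W2p_norm L p (u \- v)%R +
    W2p_norm L p (v \- w)%R)%E.
Proof.
move=> p1 [_ [gu [hu [_ _ _ ugu guhu]]]] [_ [gv [hv [_ _ _ vgv gvhv]]]]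
  [_ [gw [hw [_ _ _ wgw gwhw]]]].
have p0 : 0 < p by exact: lt_le_trans p1.
rewrite (W2p_normE p0 (weak_derivativeB ugu wgw) (weak_derivativeB guhu gwhw)).
rewrite (W2p_normE p0 (weak_derivativeB ugu vgv) (weak_derivativeB guhu gvhv)).
rewrite (W2p_normE p0 (weak_derivativeB vgv wgw) (weak_derivativeB gvhv gwhw)).
have [mu_ mgu] := weak_derivative_measurable ugu.
have [mv mgv] := weak_derivative_measurable vgv.
have [mw mgw] := weak_derivative_measurable wgw.
have [_ mhu] := weak_derivative_measurable guhu.
have [_ mhv] := weak_derivative_measurable gvhv.
have [_ mhw] := weak_derivative_measurable gwhw.
rewrite addeACA [(Lp_norm L p (u \- v)%R + _ + _)%E]addeACA.
by do 2 (apply: leeD; last exact: Lp_norm_triangle); exact: Lp_norm_triangle.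
Qed.

(** Patched coordinate by coordinate, so that the scalar result on patched functions applies to each
    coordinate. *)
Definition zero_ext (c d : R) u : curve :=
  fun s => \row_i ((fun t => u t ord0 i) \_ `[c, d]) s.

Lemma zero_extE c d u i : (fun s => zero_ext c d u s ord0 i) =
  (fun s => u s ord0 i) \_ `[c, d].
Proof. by apply/funext => s; rewrite mxE. Qed.

Lemma continuous_bounded_segment (f : R -> R) (c d : R) : continuous f ->
  exists2 M, 0 <= M & forall x, x \in `[c, d] -> `|f x| <= M.
Proof.
move=> fc.
have := compact_bounded (continuous_compact (continuous_subspaceT fc)
  (@segment_compact R c d)).
move=> [M [_ HM]]; exists (Num.max 0 (M + 1)); first by rewrite le_max lexx.
move=> x xcd; rewrite le_max; apply/orP; right; apply: (HM (M + 1)).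
  by rewrite ltrDl.
by exists x.
Qed.

Lemma mem_Lp_zero_ext L p c d u : 1 <= p -> 0 <= L ->
  (forall i, continuous (fun s => u s ord0 i)) -> mem_Lp L p (zero_ext c d u).
Proof.
move=> p1 L0 uc i; rewrite zero_extE.
have [M M0 uM] := continuous_bounded_segment c d (uc i).
set f := _ \_ _.
have mf : measurable_fun setT f.
  apply/(measurable_restrictT _ _).1 => //.
  apply: measurable_funTS; apply/(measurable_restrictT _ _).1 => //.
  by apply: measurable_funTS; exact: continuous_measurable_fun.
rewrite inE/=; apply/andP; split; first by rewrite inE.
rewrite inE/= /finite_norm.
apply: (@le_lt_trans _ _ ('N[mu]_p%:E[EFin \o (cst M \_ `]0%R, L[)])%E).
  apply: Lnorm_ae_le => //; first exact: lt_le_trans p1.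
    exact/(measurable_restrictT _ _).1.
  apply: aeW => x; rewrite /f !patchE; case: ifPn => //= _.
  rewrite (ger0_norm M0); case: ifPn; last by rewrite normr0.
  by rewrite inE => /uM.
by rewrite Lnorm_cst_patch ?ltey// (lt_le_trans ltr01).
Qed.

Lemma mem_LpD L p u v : 1 <= p -> mem_Lp L p u -> mem_Lp L p v ->
  mem_Lp L p (u \+ v).
Proof.
move=> p1 pu pv i.
have -> : (fun s => (u \+ v) s ord0 i) \_ `]0, L[ =
    ((fun s => u s ord0 i) \_ `]0, L[) \+ ((fun s => v s ord0 i) \_ `]0, L[).
  by apply/funext => s; rewrite /= !patchE; case: ifPn; rewrite ?addr0// !mxE.
have p1' : (1 <= p%:E)%E by rewrite lee_fin.
have [_ H] := @Lfun_addr_closed _ (measurableTypeR R) R mu _ p1'.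
exact: H.
Qed.

End SobolevNorm.

(** * Extension by zero, curvature of a unit tangent, rotations *)

Section Tools.
Context {R : realType}.
Local Notation mu := (@lebesgue_measure R).
Local Notation curve := (R -> 'rV[R]_2).
Implicit Types (L p M c d : R) (u v w g h : curve).

Lemma locally_integrable_eq L (f1 f2 : R -> R) :
  (forall x, x \in `]0, L[ -> f1 x = f2 x) ->
  locally_integrable `]0, L[ f1 -> locally_integrable `]0, L[ f2.
Proof.
move=> f12 [mf oL fi]; split => //.
  by apply: eq_measurable_fun mf => x /[!inE] xL; exact: f12.
move=> K KL cK; rewrite (le_lt_trans _ (fi K KL cK))//.
rewrite le_eqVlt; apply/orP; left; apply/eqP; apply: eq_integral => x.
by rewrite inE => /KL xL; rewrite f12.
Qed.

Lemma weak_derivative_eq L u v g h : (forall x, x \in `]0, L[ -> u x = v x) ->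
  (forall x, x \in `]0, L[ -> g x = h x) ->
  weak_derivative L u g -> weak_derivative L v h.
Proof.
move=> uv gh ug.
apply: (@weak_derivative_ael _ _ u); [|exact: aeW|].
  move=> i; have [lu _ _] := ug i.
  by apply: locally_integrable_eq lu => x xL; rewrite uv.
apply: (weak_derivative_aer _ _ ug); last exact: aeW.
move=> i; have [_ lg _] := ug i.
by apply: locally_integrable_eq lg => x xL; rewrite gh.
Qed.

Lemma weak_derivative_zero_ext L c d u g : 0 <= c -> c < d -> d <= L ->
  (forall i (x : R), is_derive x 1 (fun s => u s ord0 i) (g x ord0 i)) ->
  (forall i, continuous (fun s => g s ord0 i)) -> u c = 0 -> u d = 0 ->
  weak_derivative L (zero_ext c d u) (zero_ext c d g).
Proof.
move=> c0 cd dL ug gc uc ud i.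
rewrite -/(weak_deriv L (fun s => zero_ext c d u s ord0 i) (fun s => zero_ext c
  d g s ord0 i)).
rewrite !zero_extE; apply: weak_deriv_patch => //.
  by right; rewrite uc mxE.
by right; rewrite ud mxE.
Qed.

Lemma continuous_zero_ext c d u i : c <= d ->
  continuous (fun s => u s ord0 i) ->
  u c = 0 -> u d = 0 -> continuous (fun s => zero_ext c d u s ord0 i).
Proof.
move=> cd cu uc ud; rewrite zero_extE.
(* As [u] vanishes at both ends, extending by zero is the same as precomposing with the retraction
   onto [[c, d]], which is continuous. *)
have -> : (fun s => u s ord0 i) \_ `[c, d] =
    (fun s => u s ord0 i) \o (fun x => Num.max c (Num.min d x)).
  apply/funext => x; rewrite patchE /=; case: ifPn.
    by rewrite inE/= in_itv/= => /andP[cx xd]; rewrite (min_r xd) (max_r cx).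
  rewrite notin_setE/= in_itv/= => /negP;
    rewrite negb_and -!ltNge => /orP[xc|dx].
    rewrite (@max_l _ _ c) ?uc ?mxE// ge_min; apply/orP; right; exact: ltW.
  by rewrite (min_l (ltW dx)) (max_r cd) ud mxE.
move=> x; apply: continuous_comp; last exact: cu.
apply: continuous_max; first exact: cst_continuous.
by apply: continuous_min; [exact: cst_continuous|exact: cvg_id].
Qed.

Lemma zero_ext_in c d u x : x \in `[c, d] -> zero_ext c d u x = u x.
Proof.
by move=> xcd; apply/rowP => i; rewrite !mxE patchE mem_set.
Qed.

Lemma zero_ext_out c d u x : x \notin `[c, d] -> zero_ext c d u x = 0.
Proof.
by move=> /negP xcd; apply/rowP => i; rewrite !mxE patchE memNset.
Qed.

Lemma scale_rVE (a : R) (u : 'rV[R]_2) i : (a *: u) ord0 i = a * u ord0 i.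
Proof. by rewrite mxE. Qed.

Lemma rot90E0 (u : 'rV[R]_2) : rot90 u ord0 ord0 = - u ord0 ord_max.
Proof. by rewrite mxE. Qed.

Lemma rot90E1 (u : 'rV[R]_2) : rot90 u ord0 ord_max = u ord0 ord0.
Proof. by rewrite mxE. Qed.

(** Since the tangent has norm 1, [k] is the determinant of tangent and acceleration, both of which
    are measurable. *)
Lemma signed_curvature_measurable L u (k : R -> R) : arclength L u ->
  signed_curvature L u k -> measurable_fun `]0, L[ k.
Proof.
move=> au uk; have [mv mk] := weak_derivative_measurable uk.
have H : measurable_fun `]0, L[ (fun s =>
    (k s *: rot90 (velocity L u s)) ord0 ord_max * velocity L u s ord0 ord0 -
    (k s *: rot90 (velocity L u s)) ord0 ord0 * velocity L u s ord0 ord_max).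
  by apply: measurable_funB; apply: measurable_funM => //; exact: mv.
apply: eq_measurable_fun H => s /[!inE] sL.
have := enorm_sqr (velocity L u s); rewrite au ?expr1n; last first.
  exact: subset_itv_oo_cc.
rewrite /= !scale_rVE rot90E0 rot90E1 => H.
rewrite -[RHS]mulr1 H; ring.
Qed.

(** [energy] uses an arbitrary choice of curvature. Two choices give almost everywhere the same
    [k N], and [N] is a unit vector, so they agree almost everywhere. *)
Lemma energyE L f u (k : R -> R) : 0 < L ->
  measurable_fun (`[0, +oo[ : set R) f -> arclength L u ->
  signed_curvature L u k ->
  energy L f u = (\int[mu]_(s in `]0%R, L[) f `|k s|%R)%E.
Proof.
move=> L0 mf au uk.
have uc : signed_curvature L u (curvature L u) := xgetI _ uk.
have mfk (k' : R -> R) : signed_curvature L u k' ->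
    measurable_fun `]0, L[ (fun s => f `|k' s|).
  move=> uk'; have mk' := signed_curvature_measurable au uk'.
  apply: (@measurable_comp _ _ _ _ _ _ (`[0, +oo[ :
    set R) f _ (fun s => `|k' s|)) => //.
    by move=> _ [s _ <-] /=; rewrite in_itv/= normr_ge0.
  exact: measurableT_comp.
apply: ae_eq_integral => //; [exact: mfk|exact: mfk|].
have := weak_derivative_unique uc uk; apply: ae_imply => s + sL => /(_ sL) E.
suff -> : curvature L u s = k s by [].
have := enorm_sqr (velocity L u s); rewrite au ?expr1n; last first.
  exact: subset_itv_oo_cc.
have := congr1 (fun M : 'rV[R]_2 => M ord0 ord0) E.
have := congr1 (fun M : 'rV[R]_2 => M ord0 ord_max) E.
rewrite /= !scale_rVE rot90E0 rot90E1 !mulrN => H1 /oppr_inj H0 H.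
by rewrite -[LHS]mulr1 -[RHS]mulr1 H !mulrDr !expr2 !mulrA H0 H1.
Qed.

Lemma is_derive_coord u (x : R) (l : 'rV[R]_2) i : is_derive x 1 u l ->
  is_derive x 1 (fun s => u s ord0 i) (l ord0 i).
Proof.
move=> [du <-]; apply: DeriveDef; first exact: (derivable_mxP _ _ _).1.
by rewrite derive_mx// mxE.
Qed.

Definition rotate_by (t : R) (w : 'rV[R]_2) : 'rV[R]_2 :=
  \row_i (if i == ord0 then cos t * w ord0 ord0 - sin t * w ord0 ord_max
          else sin t * w ord0 ord0 + cos t * w ord0 ord_max).

Lemma rotateE0 t (w : 'rV[R]_2) : rotate_by t w ord0 ord0 =
  cos t * w ord0 ord0 - sin t * w ord0 ord_max.
Proof. by rewrite mxE. Qed.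

Lemma rotateE1 t (w : 'rV[R]_2) : rotate_by t w ord0 ord_max =
  sin t * w ord0 ord0 + cos t * w ord0 ord_max.
Proof. by rewrite mxE. Qed.

Lemma enorm_rotate t (w : 'rV[R]_2) : enorm (rotate_by t w) = enorm w.
Proof.
rewrite /enorm rotateE0 rotateE1; congr Num.sqrt.
have := cos2Dsin2 t; nra.
Qed.

Lemma rotateNK t (w : 'rV[R]_2) : rotate_by t (rotate_by (- t) w) = w.
Proof.
have H := cos2Dsin2 t.
apply: rV2P; rewrite ?(rotateE0, rotateE1) cosN sinN.
  by rewrite -[RHS]mul1r -H; ring.
by rewrite -[RHS]mul1r -H; ring.
Qed.

Lemma is_derive_rotate (Th Psi : R -> R) (w : 'rV[R]_2) i (s : R) :
  is_derive s 1 Th (Psi s) ->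
  is_derive s 1 (fun x => rotate_by (Th x) w ord0 i)
    ((Psi s *: rot90 (rotate_by (Th s) w)) ord0 i).
Proof.
move=> dTh.
have dc := is_derive1_comp (is_derive_cos (Th s)) dTh.
have ds := is_derive1_comp (is_derive_sin (Th s)) dTh.
move: i; apply: ord2P.
- have -> : (fun x => rotate_by (Th x) w ord0 ord0) = (fun x => (cos \o Th) x *
      w ord0 ord0 - (sin \o Th) x * w ord0 ord_max).
    by apply/funext => x; rewrite rotateE0.
  apply: is_derive_eq; rewrite scale_rVE rot90E0 rotateE1.
  rewrite !scaler0 !add0r /GRing.scale/=; ring.
- have -> : (fun x => rotate_by (Th x) w ord0 ord_max) =
  (fun x => (sin \o Th) x *
      w ord0 ord0 + (cos \o Th) x * w ord0 ord_max).
    by apply/funext => x; rewrite rotateE1.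
  apply: is_derive_eq; rewrite scale_rVE rot90E1 rotateE0.
  rewrite !scaler0 !add0r /GRing.scale/=; ring.
Qed.

End Tools.

(** * The competitor *)

Section Competitor.
Context {R : realType}.
Local Notation mu := (@lebesgue_measure R).
Local Notation curve := (R -> 'rV[R]_2).
Implicit Types (s x : R).

Lemma is_derive_shift (f g : R -> R) (h s : R) :
  (forall x, is_derive x 1 f (g x)) ->
  is_derive s 1 (fun x => f (x + h)) (g (s + h)).
Proof.
move=> fg.
have H : is_derive s 1 (fun x => x + h) (1 + 0) by exact: is_deriveD.
have K := @is_derive1_comp R f (fun x => x + h) s _ _ (fg (s + h)) H.
by apply: (is_derive_eq K); rewrite addr0 mulr1.
Qed.

(* [v] solves the linear system [v' = k rot90 v], hence is a rotation of a
   fixed vector by a primitive of [k]. *)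
Lemma curvature_velocity_rotate (L : R) (v : curve) (k Th Psi : R -> R) :
  0 < L ->
  {within `[0, L], continuous v} -> {within `[0, L], continuous k} ->
  weak_derivative L v (fun s => k s *: rot90 (v s)) ->
  (forall s, is_derive s 1 Th (Psi s)) ->
  (forall s, s \in `[0, L] -> k s = Psi s) ->
  exists w, forall s, s \in `[0, L] -> v s = rotate_by (Th s) w.
Proof.
move=> L0 vc kc vk dTh kPsi.
have vci := (within_continuous_rV2P _ _).1 vc.
have E0 s : (k s *: rot90 (v s)) ord0 ord0 = k s * - v s ord0 ord_max.
  by rewrite scale_rVE rot90E0.
have E1 s : (k s *: rot90 (v s)) ord0 ord_max = k s * v s ord0 ord0.
  by rewrite scale_rVE rot90E1.
have dv i : forall s, s \in `]0, L[ ->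
    is_derive s 1 (fun x => v x ord0 i) ((k s *: rot90 (v s)) ord0 i).
  apply: (@weak_deriv_is_derive R L (fun x => v x ord0 i)
    (fun s => (k s *: rot90 (v s)) ord0 i)) => //.
  move: i; apply: ord2P.
  - rewrite (funext E0); apply/subspace_continuousP => x xL.
    apply: cvgM; first by move/subspace_continuousP : kc; exact.
    by apply: cvgN; have /subspace_continuousP := vci ord_max; exact.
  - rewrite (funext E1); apply/subspace_continuousP => x xL.
    apply: cvgM; first by move/subspace_continuousP : kc; exact.
    by have /subspace_continuousP := vci ord0; exact.
have Thc := is_derive_continuous dTh.
pose w s := rotate_by (- Th s) (v s).
have wE0 : (fun s => w s ord0 ord0) =
    (fun s => (cos \o Th) s * v s ord0 ord0 + (sin \o Th) s * v s ord0 ord_max).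
  by apply/funext => s; rewrite rotateE0 cosN sinN mulNr opprK.
have wE1 : (fun s => w s ord0 ord_max) =
    (fun s => (cos \o Th) s * v s ord0 ord_max - (sin \o Th) s * v s ord0 ord0).
  by apply/funext => s; rewrite rotateE1 cosN sinN mulNr addrC.
have cosc : continuous (cos \o Th).
  by move=> s; apply: continuous_comp; [exact: Thc|exact: continuous_cos].
have sinc : continuous (sin \o Th).
  by move=> s; apply: continuous_comp; [exact: Thc|exact: continuous_sin].
have wc i : forall s, s \in `[0, L] -> w s ord0 i = w 0 ord0 i.
  apply: (derive0_constant_segment (w := fun s => w s ord0 i)).
    move: i; apply: ord2P.
    - rewrite wE0; apply/subspace_continuousP => x xL; apply: cvgD; apply: cvgM.
      + by apply: cvg_within_filter; exact: cosc.
      + by have /subspace_continuousP := vci ord0; exact.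
      + by apply: cvg_within_filter; exact: sinc.
      + by have /subspace_continuousP := vci ord_max; exact.
    - rewrite wE1; apply/subspace_continuousP => x xL; apply: cvgB; apply: cvgM.
      + by apply: cvg_within_filter; exact: cosc.
      + by have /subspace_continuousP := vci ord_max; exact.
      + by apply: cvg_within_filter; exact: sinc.
      + by have /subspace_continuousP := vci ord0; exact.
  move=> s sL.
  have d0 := dv ord0 s sL; have d1 := dv ord_max s sL.
  have dc := is_derive1_comp (is_derive_cos (Th s)) (dTh s).
  have ds := is_derive1_comp (is_derive_sin (Th s)) (dTh s).
  have kE : k s = Psi s by apply: kPsi; exact: subset_itv_oo_cc.
  move: i; apply: ord2P.
  - rewrite wE0; apply: is_derive_eq.
    by rewrite E0 E1 kE /GRing.scale/=; ring.
  - rewrite wE1; apply: is_derive_eq.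
    by rewrite E0 E1 kE /GRing.scale/=; ring.
exists (w 0) => s sL; rewrite -[LHS](rotateNK (Th s)); congr rotate_by.
by apply/rowP => i; exact: wc.
Qed.

(** [Psi], [V] and [G] are curvature, tangent and a primitive of the tangent on the whole line, tied
    to [gamma] on [[0, L]] only. The reflection symmetry of the curvature enters this section solely
    through [V (c + h) = V c]. *)
Context (L P c h p : R) (Psi : R -> R) (V G : curve) (gamma : curve).
Context (L0 : 0 < L) (P0 : 0 < P) (c0 : 0 < c) (dL : c + P < L)
  (hP : `|h| <= P) (p1 : 1 <= p).
Context (Psic : continuous Psi) (PsiP : forall s, Psi (s + P) = Psi s).
Context (dV : forall i s,
  is_derive s 1 (fun x => V x ord0 i) ((Psi s *: rot90 (V s)) ord0 i)).
Context (dG : forall i s, is_derive s 1 (fun x => G x ord0 i) (V s ord0 i)).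
Context (VP : forall s, V (s + P) = V s) (Vch : V (c + h) = V c)
  (V1 : forall s, enorm (V s) = 1).
Context (gammaarc : arclength L gamma)
  (gammaV : forall s, s \in `[0, L] -> velocity L gamma s = V s)
  (gammak : signed_curvature L gamma Psi).

Local Notation d := (c + P).

(** The constant of integration makes the correction vanish at [c]; [dtangent] and [daccel] are its
    first two derivatives. *)
Definition dposition : curve := fun s => G (s + h) - G s - (G (c + h) - G c).
Definition dtangent : curve := fun s => V (s + h) - V s.
Definition daccel : curve :=
  fun s => Psi (s + h) *: rot90 (V (s + h)) - Psi s *: rot90 (V s).

(* [gamma] with its curvature on the full period [[c, d]] replaced by the
   curvature at time [s + h]. *)
Definition competitor : curve := gamma \+ zero_ext c d dposition.

Definition competitor_curvature (s : R) : R :=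
  if s \in `[c, d] then Psi (s + h) else Psi s.

Let cd : c < d. Proof. by rewrite ltrDl. Qed.

Lemma dposition_l : dposition c = 0. Proof. by rewrite /dposition subrr. Qed.

(** The displacement [G (s + P) - G s] over a full period does not depend on [s], because [V] is
    [P]-periodic. So the replaced arc ends where the old one did. *)
Lemma dposition_r : dposition d = 0.
Proof.
have H i s t : G (s + P) ord0 i - G s ord0 i = G (t + P) ord0 i - G t ord0 i.
  apply: (@is_derive_0_is_cst R (fun s => G (s + P) ord0 i - G s ord0 i)) => x.
  have H1 := is_derive_shift P x (dG i); have H0 := dG i x.
  by apply: is_derive_eq; rewrite VP subrr.
apply/rowP => i; rewrite /dposition !mxE.
have := H i (c + h) c; rewrite (addrAC c h P); lra.
Qed.

Lemma is_derive_dposition i s :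
  is_derive s 1 (fun x => dposition x ord0 i) (dtangent s ord0 i).
Proof.
have H := is_derive_shift h s (dG i).
have H0 := dG i s.
have -> : (fun x => dposition x ord0 i) =
    (fun x => G (x + h) ord0 i - G x ord0 i - (G (c + h) - G c) ord0 i).
  by apply/funext => x; rewrite !mxE.
by apply: is_derive_eq; rewrite subr0 !mxE.
Qed.

Lemma dtangent_l : dtangent c = 0. Proof. by rewrite /dtangent Vch subrr. Qed.

Lemma dtangent_r : dtangent d = 0.
Proof. by rewrite /dtangent addrAC !VP Vch subrr. Qed.

Lemma is_derive_dtangent i s :
  is_derive s 1 (fun x => dtangent x ord0 i) (daccel s ord0 i).
Proof.
have H := is_derive_shift h s (dV i).
have H0 := dV i s.
have -> : (fun x => dtangent x ord0 i) = (fun x => V (x + h) ord0 i -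
  V x ord0 i).
  by apply/funext => x; rewrite !mxE.
by apply: is_derive_eq; rewrite !mxE.
Qed.

Lemma dposition_continuous i : continuous (fun s => dposition s ord0 i).
Proof. exact: is_derive_continuous (is_derive_dposition i). Qed.

Lemma dtangent_continuous i : continuous (fun s => dtangent s ord0 i).
Proof. exact: is_derive_continuous (is_derive_dtangent i). Qed.

Lemma V_derive_continuous i :
  continuous (fun s => (Psi s *: rot90 (V s)) ord0 i).
Proof.
have Vc j := is_derive_continuous (dV j).
move: i; apply: ord2P => s.
- rewrite (_ : (fun s => _) = (fun s => Psi s * - V s ord0 ord_max));
  last first.
    by apply/funext => t; rewrite scale_rVE rot90E0.
  by apply: cvgM; [exact: Psic|apply: cvgN; exact: Vc].
- rewrite (_ : (fun s => _) = (fun s => Psi s * V s ord0 ord0)); last first.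
    by apply/funext => t; rewrite scale_rVE rot90E1.
  by apply: cvgM; [exact: Psic|exact: Vc].
Qed.

Lemma daccel_continuous i : continuous (fun s => daccel s ord0 i).
Proof.
move=> s; rewrite (_ : (fun s => _) =
  (fun s => (fun s => (Psi s *: rot90 (V s)) ord0 i) (s + h) -
    (Psi s *: rot90 (V s)) ord0 i)); last by apply/funext => t; rewrite !mxE.
apply: cvgB; last exact: V_derive_continuous.
apply: (@continuous_comp _ _ _ (fun s => s + h)
  (fun s => (Psi s *: rot90 (V s)) ord0 i)); last exact: V_derive_continuous.
by apply: cvgD; [exact: cvg_id|exact: cvg_cst].
Qed.

Lemma weak_derivative_position :
  weak_derivative L (zero_ext c d dposition) (zero_ext c d dtangent).
Proof.
apply: weak_derivative_zero_ext (ltW c0) cd (ltW dL) _ dtangent_continuous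
  dposition_l dposition_r.
exact: is_derive_dposition.
Qed.

Lemma weak_derivative_tangent :
  weak_derivative L (zero_ext c d dtangent) (zero_ext c d daccel).
Proof.
apply: weak_derivative_zero_ext (ltW c0) cd (ltW dL) _ daccel_continuous
  dtangent_l dtangent_r.
exact: is_derive_dtangent.
Qed.

Lemma competitor_W2p : W2p L p gamma -> W2p L p competitor.
Proof.
move=> [gammac [g1 [g2 [m0 m1 m2 w1 w2]]]]; split.
  apply/within_continuous_rV2P => i.
  have gi := (within_continuous_rV2P _ _).1 gammac i.
  have Zi := continuous_zero_ext (ltW cd) (@dposition_continuous i) dposition_l
    dposition_r.
  rewrite (_ : (fun s => _) = (fun s => gamma s ord0 i +
    zero_ext c d dposition s ord0 i));
    last by apply/funext => s; rewrite /competitor mxE.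
  apply/subspace_continuousP => x xL; apply: cvgD.
    by move/subspace_continuousP : gi; exact.
  by apply: cvg_within_filter; exact: Zi.
exists (g1 \+ zero_ext c d dtangent), (g2 \+ zero_ext c d daccel); split.
- apply: mem_LpD => //; apply: mem_Lp_zero_ext => //; first exact: ltW.
  exact: dposition_continuous.
- apply: mem_LpD => //; apply: mem_Lp_zero_ext => //; first exact: ltW.
  exact: dtangent_continuous.
- apply: mem_LpD => //; apply: mem_Lp_zero_ext => //; first exact: ltW.
  exact: daccel_continuous.
- exact: weak_derivativeD w1 weak_derivative_position.
- exact: weak_derivativeD w2 weak_derivative_tangent.
Qed.

Lemma competitor_velocity :
  [/\ {within `[0, L], continuous (velocity L competitor)},
      weak_derivative L competitor (velocity L competitor) &
      forall s, s \in `[0, L] ->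
        velocity L competitor s = V s + zero_ext c d dtangent s].
Proof.
have [vc wv] := arclength_velocity L0 gammaarc.
have [] := @velocity_unique _ L competitor (velocity L gamma \+ zero_ext c d
  dtangent) L0.
- apply/within_continuous_rV2P => i.
  have gi := (within_continuous_rV2P _ _).1 vc i.
  have Zi := continuous_zero_ext (ltW cd) (@dtangent_continuous i) dtangent_l
    dtangent_r.
  rewrite (_ : (fun s => _) = (fun s => velocity L gamma s ord0 i +
    zero_ext c d dtangent s ord0 i));
    last by apply/funext => s; rewrite /= mxE.
  apply/subspace_continuousP => x xL; apply: cvgD.
    by move/subspace_continuousP : gi; exact.
  by apply: cvg_within_filter; exact: Zi.
- exact: weak_derivativeD wv weak_derivative_position.
- move=> cv wcv H; split => // s sL.
  by rewrite H// -gammaV.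
Qed.

Lemma competitor_velocity_in s : s \in `[c, d] ->
  velocity L competitor s = V (s + h).
Proof.
move=> scd; have [_ _ ->] := competitor_velocity; last first.
  by move: scd; rewrite !in_itv/=; move: c0 dL; lra.
by rewrite zero_ext_in// /dtangent addrC subrK.
Qed.

Lemma competitor_velocity_out s : s \in `[0, L] -> s \notin `[c, d] ->
  velocity L competitor s = V s.
Proof.
move=> sL scd; have [_ _ ->//] := competitor_velocity.
by rewrite zero_ext_out// addr0.
Qed.

Lemma competitor_arclength : arclength L competitor.
Proof.
move=> s sL; have [scd|scd] := boolP (s \in `[c, d]).
  by rewrite competitor_velocity_in.
by rewrite competitor_velocity_out.
Qed.

Lemma competitor_clamp Q0 Q1 U0 U1 :
  A_clamp L p Q0 Q1 U0 U1 gamma -> A_clamp L p Q0 Q1 U0 U1 competitor.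
Proof.
move=> [gW ga [g0 gL] [v0 vL]].
have o0 : 0 \notin `[c, d] by rewrite in_itv/= negb_and -ltNge c0.
have oL : L \notin `[c, d] by rewrite in_itv/= negb_and -!ltNge dL orbT.
have i0 : 0 \in `[0, L] by rewrite in_itv/= lexx ltW.
have iL : L \in `[0, L] by rewrite in_itv/= lexx ltW.
split.
- exact: competitor_W2p.
- exact: competitor_arclength.
- by rewrite /competitor /= !zero_ext_out// !addr0.
- by rewrite !competitor_velocity_out// -!gammaV.
Qed.

Lemma competitor_signed_curvature :
  signed_curvature L competitor competitor_curvature.
Proof.
apply: weak_derivative_eq (weak_derivativeD gammak weak_derivative_tangent) => s
  sL /=.
  have [_ _ ->] := competitor_velocity; last exact: subset_itv_oo_cc.
  by rewrite gammaV//; exact: subset_itv_oo_cc.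
rewrite /competitor_curvature; case: ifPn => scd.
  rewrite competitor_velocity_in// zero_ext_in// gammaV;
    last exact: subset_itv_oo_cc.
  by rewrite /daccel addrC subrK.
rewrite competitor_velocity_out//; last exact: subset_itv_oo_cc.
by rewrite zero_ext_out// addr0 gammaV//; exact: subset_itv_oo_cc.
Qed.

(** Off [[c, d]] the curvature is unchanged; on it, a full period of [f |Psi|] is merely shifted.
    Both energies may be infinite, so they are compared piece by piece rather than through their
    difference. *)
Lemma competitor_energy f : measurable_fun (`[0, +oo[ : set R) f ->
  (forall x : R, 0 <= x -> (0 <= f x)%E) ->
  energy L f competitor = energy L f gamma.
Proof.
move=> mf f0.
rewrite (energyE L0 mf competitor_arclength competitor_signed_curvature).
rewrite (energyE L0 mf gammaarc gammak).
pose g s := f `|Psi s|.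
have mg : measurable_fun setT g.
  apply: (@measurable_comp _ _ _ _ _ _ (`[0, +oo[ :
    set R) f _ (fun s => `|Psi s|)) => //.
    by move=> _ [s _ <-] /=; rewrite in_itv/= normr_ge0.
  by apply: measurableT_comp => //; exact: continuous_measurable_fun.
have g0 s : (0 <= g s)%E by apply: f0.
have mgh : measurable_fun setT (fun s : R => g (s + h)).
  by apply: measurableT_comp => //; exact: measurable_funD.
have split_itv (k : R -> \bar R) : (forall s, (0 <= k s)%E) ->
    measurable_fun `]0, L[ k -> (\int[mu]_(s in `]0%R, L[) k s =
    \int[mu]_(s in `]0%R, L[ `\` `[c, d]) k s + \int[mu]_(s in `[c, d]) k s)%E.
  move=> k0 mk.
  have E : `]0, L[%classic = (`]0, L[ `\` `[c, d]) `|` `[c, d].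
    rewrite setUC setDUK// => s /=; rewrite !in_itv/=; move: c0 dL; lra.
  rewrite {1}E ge0_integral_setU//.
  - exact: measurableD.
  - by rewrite -E.
  - by apply/disj_setPS => s [[]].
have ck0 s : (0 <= f `|competitor_curvature s|%R)%E by apply: f0.
have mck : measurable_fun `]0, L[ (fun s => f `|competitor_curvature s|).
  apply: (@measurable_comp _ _ _ _ _ _ (`[0, +oo[ : set R) f _
    (fun s => `|competitor_curvature s|)) => //.
    by move=> _ [s _ <-] /=; rewrite in_itv/= normr_ge0.
  apply: measurableT_comp => //.
  exact: signed_curvature_measurable competitor_arclength
    competitor_signed_curvature.
rewrite !split_itv//; last exact: measurable_funTS.
congr (_ + _)%E.
  apply: eq_integral => s; rewrite inE/= => -[_ /negP scd].
  by rewrite /competitor_curvature (negbTE scd).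
transitivity (\int[mu]_(s in `[c, d]) g (s + h)%R)%E.
  apply: eq_integral => s; rewrite inE/= => scd.
  by rewrite /competitor_curvature scd.
by apply: integral_period_shift => // s; rewrite /g PsiP.
Qed.

(** The factor 6 counts three Lp norms, each with the crude bound [e + e] for the Euclidean norm of
    a vector with coordinates at most [e]; the power of [L] is the Lp norm of the constant 1. *)
Lemma competitor_norm e : 0 <= e ->
  (forall s, s \in `[c, d] -> forall i, [/\ `|dposition s ord0 i| <= e,
     `|dtangent s ord0 i| <= e & `|daccel s ord0 i| <= e]) ->
  (W2p_norm L p (competitor \- gamma)%R <= (6 * e * L `^ p^-1)%:E)%E.
Proof.
move=> e0 Ze.
have p0 : 0 < p by exact: lt_le_trans p1.
have -> : competitor \- gamma = zero_ext c d dposition.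
  by apply/funext => s; rewrite /competitor /= addrC addKr.
rewrite (W2p_normE p0 weak_derivative_position weak_derivative_tangent).
have B (Z : curve) : coord_measurable L (zero_ext c d Z) ->
    (forall s, s \in `[c, d] -> forall i, `|Z s ord0 i| <= e) ->
    (Lp_norm L p (zero_ext c d Z) <= ((e + e) * (L `^ p^-1))%:E)%E.
  move=> mZ Zb; apply: Lp_norm_bound => //; [exact: ltW|exact: addr_ge0|].
  move=> s _; have [scd|scd] := boolP (s \in `[c, d]).
    by rewrite zero_ext_in//; apply: enorm_le; exact: Zb.
  by rewrite zero_ext_out//; apply: enorm_le; rewrite mxE normr0.
have [mZ0 mZ1] := weak_derivative_measurable weak_derivative_position.
have [_ mZ2] := weak_derivative_measurable weak_derivative_tangent.
have -> : 6 * e * L `^ p^-1 = (e + e) * L `^ p^-1 + (e + e) * L `^ p^-1 + (e +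
  e) * L `^ p^-1 by ring.
rewrite 2!EFinD; apply: leeD; first apply: leeD.
- by apply: B => // s /Ze H i; have [] := H i.
- by apply: B => // s /Ze H i; have [] := H i.
- by apply: B => // s /Ze H i; have [] := H i.
Qed.

(* The curvature at [c] is computed as a one-sided derivative of the tangent:
   from the left with [V], from the right with [V (_ + h)]. *)
Lemma competitor_C2 : W2p L p gamma -> C2 L competitor -> Psi (c + h) = Psi c.
Proof.
move=> [gammac _] [u1 [u2 [_ _ _ du1 du2]]].
have [vc wv] := arclength_velocity L0 gammaarc.
have dgamma i s : s \in `]0, L[ ->
    is_derive s 1 (fun x => gamma x ord0 i) (V s ord0 i).
  move=> sL; rewrite -gammaV; last exact: subset_itv_oo_cc.
  have gi := (within_continuous_rV2P _ _).1 gammac i.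
  have vi := (within_continuous_rV2P _ _).1 vc i.
  exact: (weak_deriv_is_derive L0 gi vi (wv i)).
have left_acc s e : 0 < s -> 0 < e -> exists t, [/\ t != s, `|t -
  s| < e & 0 < t < s].
  move=> s0 e0; pose r := Num.min (e / 2) (s / 2).
  have r0 : 0 < r by rewrite /r lt_min !divr_gt0.
  have re : r <= e / 2 by rewrite /r ge_min lexx.
  have rs : r <= s / 2 by rewrite /r ge_min lexx orbT.
  exists (s - r); split; [by rewrite lt_eqF// ltrBlDr ltrDl| |lra].
  by rewrite addrAC subrr add0r normrN gtr0_norm//; lra.
have right_acc s e : s < d -> 0 < e -> exists t, [/\ t != s, `|t -
  s| < e & s < t < d].
  move=> sd e0; pose r := Num.min (e / 2) ((d - s) / 2).
  have r0 : 0 < r by rewrite /r lt_min !divr_gt0// subr_gt0.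
  have re : r <= e / 2 by rewrite /r ge_min lexx.
  have rs : r <= (d - s) / 2 by rewrite /r ge_min lexx orbT.
  exists (s + r); split; [by rewrite gt_eqF// ltrDl| |lra].
  by rewrite addrAC subrr add0r gtr0_norm//; lra.
have u1l i s : 0 < s <= c -> u1 s ord0 i = V s ord0 i.
  move=> /andP[s0 sc].
  have sL : s \in `]0, L[ by rewrite in_itv/=; move: cd dL; lra.
  have eqc t : 0 < t <= c -> competitor t ord0 i = gamma t ord0 i.
    move=> /andP[t0]; rewrite le_eqVlt => /predU1P[->|tc].
      by rewrite /competitor /= zero_ext_in ?dposition_l ?addr0//
        in_itv/= lexx ltW.
    by rewrite /competitor /= zero_ext_out ?addr0// in_itv/= negb_and -ltNge tc.
  apply: is_derive_accumulation_eq (is_derive_coord i (du1 s sL)) (dgamma i s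
    sL) _ _.
    by apply: eqc; rewrite s0.
  move=> e e0; have [t [ts te /andP[t0 tls]]] := left_acc s e s0 e0.
  by exists t; split => //; apply: eqc; rewrite t0 (le_trans (ltW tls)).
have u1r i s : c <= s < d -> u1 s ord0 i = V (s + h) ord0 i.
  move=> /andP[cs sd].
  have sL : s \in `]0, L[ by rewrite in_itv/=; move: c0 dL; lra.
  have eqc t : c <= t <= d -> competitor t ord0 i = gamma t ord0 i +
    dposition t ord0 i.
    by move=> tcd; rewrite /competitor /= zero_ext_in ?mxE// in_itv.
  have dgZ : is_derive s 1 (fun x => gamma x ord0 i +
    dposition x ord0 i) (V (s + h) ord0 i).
    have H1 := dgamma i s sL; have H2 := is_derive_dposition i s.
    apply: is_derive_eq; rewrite /dtangent !mxE; ring.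
  apply: is_derive_accumulation_eq (is_derive_coord i (du1 s sL)) dgZ _ _.
    by apply: eqc; rewrite cs ltW.
  move=> e e0; have [t [ts te /andP[lst td]]] := right_acc s e sd e0.
  by exists t; split => //; apply: eqc; rewrite (le_trans cs (ltW lst)) ltW.
have cL : c \in `]0, L[ by rewrite in_itv/= c0 (lt_trans cd).
(* The classical derivative [u1] is now known on both sides of [c] and at [c], so [u2 c] can be read
   off from either side. *)
have El i : u2 c ord0 i = (Psi c *: rot90 (V c)) ord0 i.
  apply: is_derive_accumulation_eq (is_derive_coord i (du2 c cL)) (dV i c) _ _.
    by apply: u1l; rewrite c0 lexx.
  move=> e e0; have [t [ts te /andP[t0 tls]]] := left_acc c e c0 e0.
  by exists t; split => //; apply: u1l; rewrite t0 ltW.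
have Er i : u2 c ord0 i = (Psi (c + h) *: rot90 (V (c + h))) ord0 i.
  apply: is_derive_accumulation_eq (is_derive_coord i (du2 c cL))
    (is_derive_shift h c (dV i)) _ _.
    by apply: u1r; rewrite cd lexx.
  move=> e e0; have [t [ts te /andP[t0 tls]]] := right_acc c e cd e0.
  by exists t; split => //; apply: u1r; rewrite tls ltW.
have H0 := El ord0; rewrite Er Vch !scale_rVE rot90E0 !mulrN in H0.
have {}H0 := oppr_inj H0.
have H1 := El ord_max; rewrite Er Vch !scale_rVE rot90E1 in H1.
have := enorm_sqr (V c); rewrite V1 expr1n => H.
(* The two values are multiples of the same unit normal, so the factors coincide. *)
by rewrite -[LHS]mulr1 -[RHS]mulr1 H !mulrDr !expr2 !mulrA H0 H1.
Qed.

End Competitor.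

(** * Symmetries of a well-periodic curvature and the choice of the shift *)

Section WellPeriodic.
Context {R : realType}.
Implicit Types (Phi : R -> R) (T x : R).

Lemma antiperiodic_double Phi T : (forall x, Phi (x + T) = - Phi x) ->
  forall x, Phi (x + 2 * T) = Phi x.
Proof.
by move=> anti x; rewrite mulr2n mulrDl !mul1r addrA !anti opprK.
Qed.

Lemma periodic_intmul Phi (P : R) : (forall x, Phi (x + P) = Phi x) ->
  forall (m : int) x, Phi (x + m%:~R * P) = Phi x.
Proof.
move=> per; have H (n : nat) x : Phi (x + n%:R * P) = Phi x.
  elim: n x => [|n IH] x; first by rewrite mul0r addr0.
  by rewrite -natr1 mulrDl mul1r addrA per IH.
case=> n x; first exact: H.
by rewrite NegzE mulrNz mulNr -(H n.+1 (x - _)) subrK.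
Qed.

(** Reflection about [m T] is reflection about 0 followed by translation by [2 m T], a multiple of
    the period; so every zero is a center of odd symmetry. *)
Lemma odd_antiperiodic_center Phi T : (forall x, Phi (- x) = - Phi x) ->
  (forall x, Phi (x + T) = - Phi x) ->
  forall (m : int) x, Phi (m%:~R * T + x) = - Phi (m%:~R * T - x).
Proof.
move=> odd anti m x.
have per := periodic_intmul (antiperiodic_double anti).
have -> : m%:~R * T + x = - (m%:~R * T - x) + m%:~R * (2 * T) by ring.
by rewrite per odd.
Qed.

Lemma intmul_norm_lt_eq0 T (n : int) : 0 < T -> `|n%:~R * T| < T ->
  n%:~R * T = 0.
Proof.
move=> T0; rewrite normrM (gtr0_norm T0) gtr_pMl// -intr_norm.
rewrite -[1]/(1%:~R) ltr_int => n1.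
by have -> : n = 0; [lia|rewrite mulr0z mul0r].
Qed.

(** For [a > 0] the window slides left; for [a = 0] it slides right into the free length [L - P].
    The bound by [T] keeps [a - e] and [a + e] away from other zeros, and the bound by [d] is the
    smallness asked of the shift [2 e]. *)
Lemma small_shift (a P L T d : R) : 0 <= a -> a + P <= L -> P < L -> 0 < T ->
  0 < d -> exists e, [/\ 0 < `|e|, `|e| < T, `|2 * e| < d,
    0 < a - e & a - e + P < L].
Proof.
move=> a0 aPL PL T0 d0.
have small M : 0 < M -> exists r, [/\ 0 < r, r < M, r < T & 2 * r < d].
  move=> M0; exists (Num.min (M / 2) (Num.min (T / 2) (d / 4))).
  set r := Num.min _ _.
  have r0 : 0 < r by rewrite /r !lt_min !divr_gt0.
  have rM : r <= M / 2 by rewrite /r ge_min lexx.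
  have rT : r <= T / 2 by rewrite /r !ge_min lexx orbT.
  have rd : r <= d / 4 by rewrite /r !ge_min lexx !orbT.
  by split => //; lra.
have [a1|a1] := ltP 0 a.
  have [r [r0 rs rT rd]] := small a a1.
  by exists r; rewrite !gtr0_norm ?mulr_gt0//; split => //; lra.
have [|r [r0 rs rT rd]] := small (L - P); first by rewrite subr_gt0.
by exists (- r); rewrite mulrN !normrN !gtr0_norm ?mulr_gt0//; split => //; lra.
Qed.

Lemma small_factor (C d : R) : 0 <= C -> 0 < d ->
  exists2 e, 0 < e & 6 * (e + e) * C < d.
Proof.
(* The added 1 keeps the denominator positive when [C = 0] and makes the final inequality strict. *)
move=> C0 d0; have C1 : 0 < 12 * C + 1 by lra.
exists (d / (12 * C + 1)); first exact: divr_gt0.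
have -> : 6 * (d / (12 * C + 1) + d / (12 * C + 1)) * C =
    d * (12 * C) / (12 * C + 1) by field; lra.
by rewrite ltr_pdivrMr// ltr_pM2l// ltrDl.
Qed.

(** The indices are strictly increasing integers, so [m3] is at least [m1 + 2]. *)
Lemma three_zeros_gap (T s1 s2 s3 s0 : R) (m1 m2 m3 : int) : 0 < T ->
  s1 - s0 = m1%:~R * T -> s2 - s0 = m2%:~R * T -> s3 - s0 = m3%:~R * T ->
  s1 < s2 -> s2 < s3 -> s1 + 2 * T <= s3.
Proof.
move=> T0 E1 E2 E3 s12 s23.
have m12 : m1 < m2.
  by rewrite -(ltr_int R) -(ltr_pM2r T0) -E1 -E2 ltrD2r.
have m23 : m2 < m3.
  by rewrite -(ltr_int R) -(ltr_pM2r T0) -E2 -E3 ltrD2r.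
have m13 : m1 + 2 <= m3 by lia.
rewrite -(ler_int R) in m13.
have : (m1 + 2)%:~R * T <= m3%:~R * T by rewrite ler_pM2r.
rewrite intrD mulrDl -E1 -E3 (_ : 2%:~R = 2)//; lra.
Qed.

Lemma curve_uniform_shift (u : R -> 'rV[R]_2) (L e : R) :
  (forall i, continuous (fun s => u s ord0 i)) -> 0 < e ->
  exists2 d, 0 < d & forall h, `|h| < d -> forall s, s \in `[0, L] ->
    forall i, `|u (s + h) ord0 i - u s ord0 i| < e.
Proof.
move=> uc e0.
have [d0 d00 H0] := continuous_uniform_shift 0 L (uc ord0) e0.
have [d1 d10 H1] := continuous_uniform_shift 0 L (uc ord_max) e0.
exists (Num.min d0 d1); first by rewrite lt_min d00.
move=> h; rewrite lt_min => /andP[h0 h1] s sL.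
by apply: ord2P; [exact: H0|exact: H1].
Qed.

Lemma curve_primitive (V : R -> 'rV[R]_2) :
  (forall i, continuous (fun s => V s ord0 i)) ->
  exists G : R -> 'rV[R]_2, forall i (s : R),
    is_derive s 1 (fun x => G x ord0 i) (V s ord0 i).
Proof.
move=> Vc.
have [G0 dG0] := continuous_primitive (Vc ord0).
have [G1 dG1] := continuous_primitive (Vc ord_max).
exists (fun s => \row_i if i == ord0 then G0 s else G1 s).
apply: ord2P => s.
- rewrite (_ : (fun x => _) = G0)//.
  by apply/funext => x; rewrite mxE.
- rewrite (_ : (fun x => _) = G1)//.
  by apply/funext => x; rewrite mxE.
Qed.

(** The construction is purely geometric: [eta] is chosen before [f], and the energies agree for
    every admissible [f]. *)
Lemma well_periodic_competitor (p L : R) (Q0 Q1 U0 U1 : 'rV[R]_2)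
    (gamma : R -> 'rV[R]_2) (k : R -> R) (s1 s2 s3 delta : R) :
  1 < p -> 0 < L -> A_clamp L p Q0 Q1 U0 U1 gamma -> well_periodic L gamma k ->
  0 <= s1 -> s1 < s2 -> s2 < s3 -> s3 <= L -> s3 - s1 < L ->
  k s1 = 0 -> k s2 = 0 -> k s3 = 0 -> 0 < delta ->
  exists eta, [/\ A_clamp L p Q0 Q1 U0 U1 eta,
    (W2p_norm L p (eta \- gamma)%R < delta%:E)%E, ~ C2 L eta &
    forall f : R -> \bar R, measurable_fun (`[0, +oo[ : set R) f ->
      (forall x : R, 0 <= x -> (0 <= f x)%E) ->
      energy L f eta = energy L f gamma].
Proof.
move=> hp hL hgamma hk hs1 hs12 hs23 hs3 hs31 hk1 hk2 hk3 delta0.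
have [ga kc gk [s0 [T [Phi [[T0 Phic] odd anti zeros kPhi]]]]] := hk.
have zero s : s \in `[0, L] -> k s = 0 -> exists m : int, s - s0 = m%:~R * T.
  move=> sL; rewrite kPhi// => Phi0.
  have : [set x | Phi x = 0] (s - s0) by [].
  by rewrite zeros.
have [m1 E1] : exists m : int, s1 - s0 = m%:~R * T.
  by apply: zero => //; rewrite in_itv/=; lra.
have [m2 E2] : exists m : int, s2 - s0 = m%:~R * T.
  by apply: zero => //; rewrite in_itv/=; lra.
have [m3 E3] : exists m : int, s3 - s0 = m%:~R * T.
  by apply: zero => //; rewrite in_itv/=; lra.
have gap := three_zeros_gap T0 E1 E2 E3 hs12 hs23.
set P := 2 * T in gap.
have hP0 : 0 < P by rewrite mulr_gt0.
pose Psi s := Phi (s - s0).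
have Psic : continuous Psi.
  move=> s; apply: (@continuous_comp _ _ _ (fun s => s - s0) Phi);
    last exact: Phic.
  by apply: cvgB; [exact: cvg_id|exact: cvg_cst].
have PsiP s : Psi (s + P) = Psi s.
  by rewrite /Psi addrAC (antiperiodic_double anti).
have Psiodd x : Psi (s1 + x) = - Psi (s1 - x).
  have E y : s1 + y - s0 = m1%:~R * T + y by rewrite -E1; ring.
  by rewrite /Psi !E (odd_antiperiodic_center odd anti).
have Psi_neq0 x : 0 < `|x| -> `|x| < T -> Psi (s1 + x) != 0.
  move=> x0 xT; apply/eqP; rewrite /Psi addrAC E1 => Phi0.
  have : [set x | Phi x = 0] (m1%:~R * T + x) by [].
  rewrite zeros => -[n nE].
  have xE : x = (n - m1)%:~R * T by rewrite intrD mulrDl mulrNz mulNr -nE; ring.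
  rewrite xE in x0 xT; move: x0.
  by rewrite (intmul_norm_lt_eq0 T0 xT) normr0 ltxx.
have [Th dTh] := continuous_primitive Psic.
(* The difference of the two sides has derivative [Psi (s1 + x) + Psi (s1 - x) = 0] and vanishes at
   [x = 0]. *)
have Th_even x : Th (s1 + x) = Th (s1 - x).
  have D (y : R) : is_derive y 1 (fun x => Th (s1 + x) - Th (s1 - x)) 0.
    have D1 : is_derive y 1 (fun x => s1 + x) (0 + 1).
      exact: is_deriveD.
    have D2 : is_derive y 1 (fun x => s1 - x) (0 - 1).
      exact: is_deriveB.
    have K1 := @is_derive1_comp R Th (fun x => s1 + x) y _ _ (dTh (s1 + y)) D1.
    have K2 := @is_derive1_comp R Th (fun x => s1 - x) y _ _ (dTh (s1 - y)) D2.
    apply: (is_derive_eq (is_deriveB K1 K2)).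
    by rewrite Psiodd; ring.
  have /= := is_derive_0_is_cst x 0 D.
  by rewrite addr0 subr0 subrr => /eqP; rewrite subr_eq0 => /eqP.
have ThP s : Th (s + P) = Th s.
  have D (y : R) : is_derive y 1 (fun x => Th (x + P) - Th x) 0.
    apply: (is_derive_eq (is_deriveB (is_derive_shift P y dTh) (dTh y))).
    by rewrite PsiP subrr.
  (* The constant is evaluated at [s1 - T], where it is [Th (s1 + T) - Th (s1 - T)], zero by
     evenness. *)
  have /= := is_derive_0_is_cst s (s1 - T) D.
  rewrite -Th_even (_ : s1 - T + P = s1 + T); last by rewrite /P; ring.
  by rewrite subrr => /eqP; rewrite subr_eq0 => /eqP.
have [vc wv] := arclength_velocity hL ga.
have [w Vw] := curvature_velocity_rotate hL vc kc gk dTh kPhi.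
pose V s := rotate_by (Th s) w.
have dV i (s : R) : is_derive s 1 (fun x => V x ord0 i) ((Psi s *: rot90 (V s))
  ord0 i).
  exact: is_derive_rotate.
have VP s : V (s + P) = V s by rewrite /V ThP.
have i0 : 0 \in `[0, L] by rewrite in_itv/= lexx ltW.
have hV s : enorm (V s) = 1.
  by rewrite enorm_rotate -(enorm_rotate (Th 0)) -Vw// ga.
have Vc i := is_derive_continuous (dV i).
have [G dG] := curve_primitive Vc.
have Gc i := is_derive_continuous (dG i).
have VdC := V_derive_continuous Psic dV.
have gammaPsi : signed_curvature L gamma Psi.
  apply: weak_derivative_eq gk => // s sL.
  by rewrite kPhi//; exact: subset_itv_oo_cc.
have gW : W2p L p gamma by case: hgamma.
have p1 := ltW hp.
have p0 : 0 < p by exact: lt_trans hp.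
have [eps eps0 eps_small] := small_factor (powR_ge0 L p^-1) delta0.
have [d0 d00 H0] := curve_uniform_shift L Gc eps0.
have [d1 d10 H1] := curve_uniform_shift L Vc eps0.
have [d2 d20 H2] := curve_uniform_shift L VdC eps0.
pose dd := Num.min d0 (Num.min d1 d2).
have dd0 : 0 < dd by rewrite /dd !lt_min d00 d10.
have PL : P < L.
  by rewrite (le_lt_trans _ hs31)// lerBrDr addrC.
have [e [e0 eT edd ce de]] := small_shift hs1 (le_trans gap hs3) PL T0 dd0.
pose c := s1 - e; pose h := 2 * e.
have chE : c + h = s1 + e by rewrite /c /h; ring.
have Vch : V (c + h) = V c by rewrite chE /V Th_even.
have hP' : `|h| <= P by rewrite normrM ger0_norm// ler_pM2l// ltW.
pose eta := competitor P c h G gamma.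
have etaA := competitor_clamp hL hP0 ce de p1 Psic dV dG VP Vch hV ga Vw hgamma.
have eta_near : (W2p_norm L p (eta \- gamma)%R < delta%:E)%E.
  apply: (le_lt_trans (@competitor_norm _ L P c h p Psi V G gamma hL hP0 ce de
    p1
    Psic dV dG VP Vch (eps + eps) _ _)).
  - exact: (addr_ge0 (ltW eps0) (ltW eps0)).
  - move=> s scd i.
    have sL : s \in `[0, L].
      move: scd; rewrite !in_itv/= => /andP[cs sd].
      by rewrite (le_trans (ltW ce))// (le_trans sd)// ltW.
    have cL : c \in `[0, L].
      rewrite in_itv/= (ltW ce)/= (le_trans _ (ltW de))//.
      by rewrite lerDl ltW.
    have hd : `|h| < dd by [].
    have hd0 : `|h| < d0 by rewrite (lt_le_trans hd)// /dd ge_min lexx.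
    have hd1 : `|h| < d1 by rewrite (lt_le_trans hd)// /dd !ge_min lexx !orbT.
    have hd2 : `|h| < d2 by rewrite (lt_le_trans hd)// /dd !ge_min lexx !orbT.
    have eps2 : eps <= eps + eps by rewrite lerDl; exact: ltW.
    split; [|apply: le_trans eps2; apply: ltW..].
    (* The correction of the position is a difference of two shift increments of [G], at [s] and at
       [c]; hence the bound [eps + eps]. *)
    + rewrite !mxE; apply: (le_trans (ler_normB _ _)).
      by apply: lerD; apply: ltW; exact: H0.
    + by have := H1 h hd1 s sL i; rewrite !mxE.
    + by have := H2 h hd2 s sL i; rewrite !mxE.
  - by rewrite lte_fin.
exists eta; split; [exact: etaA|exact: eta_near| |].
  move=> etaC2.
  have := competitor_C2 hL hP0 ce de dV dG Vch hV ga Vw gW etaC2.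
  rewrite chE /c.
  (* C^2 regularity would give [Psi (s1 + e) = Psi (s1 - e)], and oddness then [Psi (s1 + e) = 0],
     although [0 < |e| < T]. *)
  rewrite -[Psi (s1 - e)]opprK -Psiodd.
  move=> /eqP; rewrite -addr_eq0 -mulr2n mulrn_eq0 /=.
  exact/negP/Psi_neq0.
move=> f hf hf0.
exact: (competitor_energy hL hP0 ce de hP' Psic PsiP dV dG VP Vch hV ga Vw
  gammaPsi hf hf0).
Qed.

End WellPeriodic.

Unset Implicit Arguments.

Theorem theorem2p3 (R : realType) (p L : R) (P0 P1 V0 V1 : 'rV[R]_2)
    (f : R -> \bar R)
    (hp : 1 < p) (hL : 0 < L)
    (hP : enorm (P0 - P1) < L) (hV0 : enorm V0 = 1) (hV1 : enorm V1 = 1)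
    (hf : measurable_fun (`[0, +oo[ : set R) f)
    (hf0 : forall x : R, 0 <= x -> (0 <= f x)%E)
    (hreg : forall eta : R -> 'rV[R]_2,
      local_minimizer L p (energy L f) (A_clamp L p P0 P1 V0 V1) eta ->
      C2 L eta)
    (gamma : R -> 'rV[R]_2) (k : R -> R)
    (hgamma : A_clamp L p P0 P1 V0 V1 gamma)
    (hk : well_periodic L gamma k)
    (s1 s2 s3 : R) (hs1 : 0 <= s1) (hs12 : s1 < s2) (hs23 : s2 < s3)
    (hs3 : s3 <= L) (hs31 : s3 - s1 < L)
    (hk1 : k s1 = 0) (hk2 : k s2 = 0) (hk3 : k s3 = 0) :
  ~ local_minimizer L p (energy L f) (A_clamp L p P0 P1 V0 V1) gamma.
Proof.
move=> [_ [delta delta0 gammamin]].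
(* With [eta] within [delta / 2] of [gamma], the ball of radius [delta / 2] about [eta] lies in the
   ball where [gamma] is minimal; as the energies are equal, [eta] is a local minimizer. *)
have delta2 : 0 < delta / 2 by rewrite divr_gt0.
have [eta [etaA eta_near eta_notC2 etaF]] := well_periodic_competitor hp hL
  hgamma hk hs1 hs12 hs23 hs3 hs31 hk1 hk2 hk3 delta2.
apply: eta_notC2; apply: hreg; split; first exact: etaA.
exists (delta / 2); first exact: delta2.
move=> zeta zetaA zeta_near.
rewrite (etaF f hf hf0); apply: gammamin; first exact: zetaA.
have [zW _ _ _] := zetaA; have [eW _ _ _] := etaA; have [gW _ _ _] := hgamma.
apply: (le_lt_trans (W2p_norm_triangle (ltW hp) zW eW gW)).
by rewrite [in ltRHS](splitr delta) EFinD; exact: (lteD zeta_near eta_near).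
Qed.
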